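(* Let $m\ge 1$ and let $\alpha_1,\ldots,\alpha_m$ be rational numbers, none of which lies in $\{0,-1,-2,\ldots\}$, such that $\alpha_i-\alpha_j\notin\mathbb{Z}$ for $i\neq j$. Write $\alpha_j=r_j/s_j$ with coprime integers $r_j$, $s_j\ge 1$, and let $s=\operatorname{lcm}\{s_1,\ldots,s_m\}$. Then there exists a constant $c>0$, depending only on $\alpha_1,\ldots,\alpha_m$ and $m$, with the following property. Let $a\in\mathbb{Z}\setminus\{0\}$ and let $P_1$ be a set of prime numbers none of which divides $s$. If \[ \limsup_{n\to\infty} c^n\,|a|^{mn+1}\,(mn)!\prod_{p\in P_1}\left|a^{mn+n+1}(mn)!\,(n+1)!\right|_p=0, \] then there is no $(\ell_0,\ell_1,\ldots,\ell_m)\in\mathbb{Z}^{m+1}\setminus\{0\}$ such that $L_p=0$ for all $p\in P_1$, where $L_p=\ell_0+\ell_1\varphi_{1,p}(a)+\cdots+\ell_m\varphi_{m,p}(a)\in\mathbb{Q}_p$.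
   Context: Pochhammer symbol: $(\alpha)_0=1$, $(\alpha)_n=\alpha(\alpha+1)\cdots(\alpha+n-1)$ for $n\ge1$. For $j=1,\ldots,m$ let $\varphi_j(z)={}_2F_0(\alpha_j,1\mid z)=\sum_{n=0}^\infty(\alpha_j)_n z^n$. For a prime $p\nmid s_j$ this series converges in $\mathbb{Q}_p$ for all $|z|_p\le 1$; $\varphi_{j,p}(a)$ denotes its sum in $\mathbb{Q}_p$ at $z=a$. $|\cdot|$ is the usual absolute value and $|\cdot|_p$ the $p$-adic absolute value. A relation $L=0$ with all $L_p=0$, $p\in P_1$, is called a $P_1$-global relation; the theorem says there are no $P_1$-global relations. *)

(* Defs.v *)
From HB Require Import structures.
From mathcomp Require Import all_boot all_order all_algebra.
From mathcomp Require Import all_classical all_reals all_analysis.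

Set Implicit Arguments.
Unset Strict Implicit.
Unset Printing Implicit Defensive.

Import Order.TTheory GRing.Theory Num.Theory.
Import numFieldNormedType.Exports.

Local Open Scope classical_set_scope.
Local Open Scope ring_scope.

Notation prime_nat := {p : nat | prime p}.

Definition padic_abs (p : prime_nat) (x : rat) : rat :=
  if x == 0 then 0
  else (val p)%:R ^+ logn (val p) `|denq x| / (val p)%:R ^+ logn (val p) `|numq x|.

Section PadicAbs.
Variable p : prime_nat.
Implicit Types x y : rat.
Let q : nat := val p.
Let pr : prime q := valP p.
Local Notation abs := (padic_abs p).
Local Notation w z := (q%:R ^+ logn q `|z| : rat).

Let qgt0 : 0 < (q%:R : rat). Proof. by rewrite ltr0n prime_gt0. Qed.
Let wgt0 (z : int) : 0 < w z. Proof. by rewrite exprn_gt0. Qed.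
Let wn0 (z : int) : w z != 0. Proof. by rewrite gt_eqF. Qed.

Let wM (a b : int) : a != 0 -> b != 0 -> w (a * b) = w a * w b.
Proof. by move=> a0 b0; rewrite abszM lognM ?absz_gt0// exprD. Qed.

Lemma padic_absE (n d : int) : n != 0 -> d != 0 ->
  abs (n%:~R / d%:~R) = w d / w n.
Proof.
move=> n0 d0; set x : rat := n%:~R / d%:~R.
have x0 : x != 0 by rewrite mulf_neq0// ?invr_eq0 intr_eq0.
have dx0 : denq x != 0 := denq_neq0 x.
have nx0 : numq x != 0 by rewrite numq_eq0.
rewrite /padic_abs (negbTE x0) -/q.
apply/eqP; rewrite eqr_div ?wn0// -!wM//.
suff -> : denq x * n = d * numq x by [].
apply/eqP; rewrite -(eqr_int rat) !intrM numqE /x.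
by rewrite mulrA [d%:~R * _]mulrC divfK ?intr_eq0// mulrC.
Qed.

Lemma padic_abs0 : abs 0 = 0. Proof. by rewrite /padic_abs eqxx. Qed.

Lemma padic_abs_gt0 x : (0 < abs x) = (x != 0).
Proof.
rewrite /padic_abs; have [_|_] := eqVneq; first by rewrite ltxx.
by rewrite divr_gt0.
Qed.

Lemma padic_abs_ge0 x : 0 <= abs x.
Proof.
have [->|x0] := eqVneq x 0; first by rewrite padic_abs0.
by rewrite ltW// padic_abs_gt0.
Qed.

Lemma padic_absM x y : abs (x * y) = abs x * abs y.
Proof.
have [->|x0] := eqVneq x 0; first by rewrite mul0r padic_abs0 mul0r.
have [->|y0] := eqVneq y 0; first by rewrite mulr0 padic_abs0 mulr0.
rewrite -[x]divq_num_den -[y]divq_num_den mulf_div -!intrM.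
by rewrite !padic_absE ?wM ?mulf_neq0 ?denq_neq0 ?numq_eq0// mulf_div.
Qed.

Lemma padic_absN x : abs (- x) = abs x.
Proof. by rewrite /padic_abs oppr_eq0 denqN numqN abszN. Qed.

Lemma padic_absB x y : abs (x - y) = abs (y - x).
Proof. by rewrite -padic_absN opprB. Qed.

Lemma padic_abs1 : abs 1 = 1.
Proof. by rewrite /padic_abs/= logn1 expr0 divr1. Qed.

Lemma padic_absV x : abs x^-1 = (abs x)^-1.
Proof.
have [->|x0] := eqVneq x 0; first by rewrite invr0 padic_abs0.
have ax0 : abs x != 0 by rewrite gt_eqF// padic_abs_gt0.
by apply: (mulIf ax0); rewrite -padic_absM !mulVf// padic_abs1.
Qed.

Lemma padic_absD x y : abs (x + y) <= Num.max (abs x) (abs y).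
Proof.
have [->|x0] := eqVneq x 0.
  by rewrite add0r le_max lexx orbT.
have [->|y0] := eqVneq y 0.
  by rewrite addr0 le_max lexx.
have [->|s0] := eqVneq (x + y) 0.
  by rewrite padic_abs0 le_max padic_abs_ge0.
set d := denq x * denq y.
have dn0 : d != 0 by rewrite mulf_neq0 ?denq_neq0.
set a := numq x * denq y; set b := numq y * denq x.
have xE : x = a%:~R / d%:~R.
  apply: (canRL (mulfK _)); first by rewrite intr_eq0.
  by rewrite /a /d !intrM numqE mulrA.
have yE : y = b%:~R / d%:~R.
  apply: (canRL (mulfK _)); first by rewrite intr_eq0.
  by rewrite /b /d !intrM numqE mulrAC mulrA.
have sE : x + y = (a + b)%:~R / d%:~R by rewrite xE yE intrD mulrDl.
have a0 : a != 0 by apply: contra_neq x0 => a0; rewrite xE a0 mul0r.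
have b0 : b != 0 by apply: contra_neq y0 => b0; rewrite yE b0 mul0r.
have ab0 : a + b != 0 by apply: contra_neq s0 => ab0; rewrite sE ab0 mul0r.
rewrite sE {1}xE {1}yE !padic_absE// le_max !ler_pM2l// !lef_pV2 ?posrE//.
rewrite !ler_eXn2l ?ltr1n ?prime_gt1// -geq_min.
set k := minn _ _.
have pd (z : int) : z != 0 -> (k <= logn q `|z|)%N = ((q ^ k)%:Z %| z)%Z.
  by move=> z0; rewrite dvdzE/= pfactor_dvdn// absz_gt0.
by rewrite pd// rpredD// -pd// geq_min leqnn ?orbT.
Qed.

Lemma padic_absD_eq x y : abs (y - x) < abs x -> abs y = abs x.
Proof.
move=> h; apply/eqP; rewrite eq_le; apply/andP; split.
  have := padic_absD (y - x) x; rewrite subrK => /le_trans; apply.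
  by rewrite ge_max lexx ltW.
have := padic_absD (x - y) y; rewrite subrK le_max padic_absB.
by rewrite leNgt h.
Qed.

End PadicAbs.

Definition padic_cauchy (p : prime_nat) : {pred nat -> rat} :=
  fun u => `[< forall e : rat, 0 < e -> exists N, forall m n,
    (N <= m)%N -> (N <= n)%N -> padic_abs p (u m - u n) < e >].

Definition padic_null (p : prime_nat) (u : nat -> rat) : Prop :=
  forall e : rat, 0 < e -> exists N, forall n,
    (N <= n)%N -> padic_abs p (u n) < e.

Section CauchyRing.
Variable p : prime_nat.
Implicit Types u v : nat -> rat.
Local Notation abs := (padic_abs p).

Lemma padic_cauchyP u : reflect (forall e : rat, 0 < e -> exists N, forall m n,
  (N <= m)%N -> (N <= n)%N -> abs (u m - u n) < e) (u \in padic_cauchy p).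
Proof. exact: asboolP. Qed.

Lemma padic_null_cauchy u : padic_null p u -> u \in padic_cauchy p.
Proof.
move=> u0; apply/padic_cauchyP => e /u0[N uN]; exists N => m n Nm Nn.
rewrite (le_lt_trans (padic_absD _ _ _))// padic_absN.
by rewrite gt_max !uN.
Qed.

Lemma padic_cauchy_dich u : u \in padic_cauchy p ->
  padic_null p u \/
  exists2 r, 0 < r & exists N, forall n, (N <= n)%N -> abs (u n) = r.
Proof.
move=> /padic_cauchyP cu; have [|nu] := pselect (padic_null p u); first by left.
right; move: nu => /existsNP[e /not_implyP[e0 /forallNP ne]].
have [N uN] := cu _ e0.
have /existsNP[n /not_implyP[Nn /negP]] := ne N; rewrite -leNgt => en.
exists (abs (u n)); first exact: lt_le_trans en.
exists N => m Nm; apply: padic_absD_eq.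
by rewrite (lt_le_trans _ en)// uN.
Qed.

Lemma padic_cauchy_bounded u : u \in padic_cauchy p ->
  exists2 C, 0 < C & exists N, forall n, (N <= n)%N -> abs (u n) <= C.
Proof.
move=> /padic_cauchy_dich[/(_ 1 ltr01)[N uN]|[r r0 [N uN]]].
  by exists 1 => //; exists N => n /uN/ltW.
by exists r => //; exists N => n /uN ->.
Qed.

Lemma padic_nullD u v : padic_null p u -> padic_null p v -> padic_null p (u + v).
Proof.
move=> u0 v0 e e0; have [N uN] := u0 _ e0; have [M vM] := v0 _ e0.
exists (maxn N M) => n; rewrite geq_max => /andP[Nn Mn].
by rewrite (le_lt_trans (padic_absD _ _ _))// gt_max uN// vM.
Qed.

Lemma padic_nullMl u v : u \in padic_cauchy p -> padic_null p v ->
  padic_null p (u * v).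
Proof.
move=> /padic_cauchy_bounded[C C0 [N uN]] v0 e e0.
have [M vM] := v0 (e / C) (divr_gt0 e0 C0).
exists (maxn N M) => n; rewrite geq_max => /andP[Nn Mn].
rewrite padic_absM (@le_lt_trans _ _ (C * abs (v n)))//.
  by rewrite ler_wpM2r ?padic_abs_ge0 ?uN.
by rewrite mulrC -ltr_pdivlMr// vM.
Qed.

Lemma padic_cauchy_subring : subring_closed (padic_cauchy p).
Proof.
split.
- apply/padic_cauchyP => e e0; exists 0%N => m n _ _.
  by rewrite subrr padic_abs0.
- move=> u v /padic_cauchyP cu /padic_cauchyP cv; apply/padic_cauchyP => e e0.
  have [N uN] := cu _ e0; have [M vM] := cv _ e0.
  exists (maxn N M) => m n; rewrite !geq_max => /andP[Nm Mm] /andP[Nn Mn].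
  have -> : (u - v) m - (u - v) n = (u m - u n) - (v m - v n).
    by rewrite [LHS]/= !opprD !opprK addrACA.
  rewrite (le_lt_trans (padic_absD _ _ _))// padic_absN.
  by rewrite gt_max uN// vM.
- move=> u v cu cv; apply/padic_cauchyP => e e0.
  have [C C0 [N1 uC]] := padic_cauchy_bounded cu.
  have [D D0 [M1 vD]] := padic_cauchy_bounded cv.
  have [N uN] := padic_cauchyP _ cu (e / D) (divr_gt0 e0 D0).
  have [M vM] := padic_cauchyP _ cv (e / C) (divr_gt0 e0 C0).
  exists (maxn (maxn N N1) (maxn M M1)) => m n.
  rewrite !geq_max => /andP[/andP[Nm N1m] /andP[Mm M1m]].
  move=> /andP[/andP[Nn N1n] /andP[Mn M1n]].
  have -> : (u * v) m - (u * v) n = u m * (v m - v n) + (u m - u n) * v n.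
    by rewrite [LHS]/= mulrBr mulrBl addrA subrK.
  rewrite (le_lt_trans (padic_absD _ _ _))// !padic_absM gt_max.
  apply/andP; split.
    rewrite (@le_lt_trans _ _ (C * abs (v m - v n)))//.
      by rewrite ler_wpM2r ?padic_abs_ge0 ?uC.
    by rewrite mulrC -ltr_pdivlMr// vM.
  rewrite (@le_lt_trans _ _ (abs (u m - u n) * D))//.
    by rewrite ler_wpM2l ?padic_abs_ge0 ?vD.
  by rewrite -ltr_pdivlMr// uN.
Qed.

HB.instance Definition _ :=
  GRing.isSubringClosed.Build (nat -> rat) (padic_cauchy p) padic_cauchy_subring.

Record padic_cauchy_seq := PadicCauchySeq {
  padic_cauchy_val :> nat -> rat;
  _ : padic_cauchy_val \in padic_cauchy p }.

HB.instance Definition _ := [isSub for padic_cauchy_val].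
HB.instance Definition _ := [Choice of padic_cauchy_seq by <:].
HB.instance Definition _ := [SubChoice_isSubComNzRing of padic_cauchy_seq by <:].

Definition padic_null_ideal : {pred padic_cauchy_seq} :=
  fun x => `[< padic_null p (val x) >].

Lemma padic_null_idealr : idealr_closed padic_null_ideal.
Proof.
split.
- by apply/asboolP => e e0; exists 0%N => n _; rewrite padic_abs0.
- apply/negP => /asboolP/(_ 1 ltr01)[N /(_ N (leqnn _))].
  by rewrite [val _ _]/= padic_abs1 ltxx.
- move=> a u v /asboolP u0 /asboolP v0; apply/asboolP.
  exact: padic_nullD (padic_nullMl (valP a) u0) v0.
Qed.

HB.instance Definition _ :=
  isIdealr.Build padic_cauchy_seq padic_null_ideal padic_null_idealr.

End CauchyRing.
Arguments padic_null_ideal p : clear implicits.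

(* The field of p-adic numbers: Cauchy sequences of rationals for the p-adic
   absolute value, modulo null sequences. *)
Definition padic (p : prime_nat) := {ideal_quot (padic_null_ideal p)}.

HB.instance Definition _ p := GRing.ComNzRing.on (padic p).
HB.instance Definition _ p := EqQuotient.on (padic p).

Section PadicField.
Variable p : prime_nat.
Implicit Types (x y : padic p) (u v : padic_cauchy_seq p).
Local Notation abs := (padic_abs p).
Local Open Scope quotient_scope.
Local Notation pi := (\pi_(padic p)).

Lemma padic_eqP u v : reflect (padic_null p (val u - val v)) (pi u == pi v).
Proof. by rewrite -Quotient.idealrBE; exact: asboolP. Qed.

Lemma padic_piD u v : pi (u + v) = pi u + pi v.
Proof. exact: (rmorphD \pi_{ideal_quot (padic_null_ideal p)}). Qed.

Lemma padic_piN u : pi (- u) = - pi u.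
Proof. exact: (rmorphN \pi_{ideal_quot (padic_null_ideal p)}). Qed.

Lemma padic_piM u v : pi (u * v) = pi u * pi v.
Proof. exact: (rmorphM \pi_{ideal_quot (padic_null_ideal p)}). Qed.

Lemma padic_pi0 : pi 0 = 0.
Proof. exact: (rmorph0 \pi_{ideal_quot (padic_null_ideal p)}). Qed.

Lemma padic_pi1 : pi 1 = 1.
Proof. exact: (rmorph1 \pi_{ideal_quot (padic_null_ideal p)}). Qed.

Lemma padic_eq0P u : reflect (padic_null p (val u)) (pi u == 0).
Proof.
rewrite -padic_pi0; have -> : val u = val u - val (0 : padic_cauchy_seq p).
  by apply/funext => n; exact/esym/subr0.
exact: padic_eqP.
Qed.

Lemma padic_neq0 u : pi u != 0 ->
  exists2 r, 0 < r & exists N, forall n, (N <= n)%N -> abs (val u n) = r.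
Proof. by move=> /padic_eq0P nu; case: (padic_cauchy_dich (valP u)). Qed.

Definition padic_inv x : padic p :=
  if x == 0 then 0 else pi (insubd 0 (fun n => (val (repr x) n)^-1)).

Fact padic_mulVf x : x != 0 -> padic_inv x * x = 1.
Proof.
move=> x0; rewrite /padic_inv (negbTE x0) -[X in _ * X](reprK x).
have := x0; rewrite -(reprK x) => /padic_neq0; rewrite reprK.
set u := repr x => -[r r0 [N uN]].
have uN0 n : (N <= n)%N -> val u n != 0.
  by move=> /uN ur; rewrite -(padic_abs_gt0 p) ur.
have cv : (fun n => (val u n)^-1) \in padic_cauchy p.
  apply/padic_cauchyP => e e0.
  have [M uM] := padic_cauchyP _ _ (valP u) (e * (r * r)) (mulr_gt0 e0 (mulr_gt0 r0 r0)).
  exists (maxn N M) => m n; rewrite !geq_max => /andP[Nm Mm] /andP[Nn Mn].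
  have -> : (val u m)^-1 - (val u n)^-1 =
      (val u n - val u m) / (val u m * val u n).
    rewrite invfM mulrBl mulrCA divff ?uN0// mulr1.
    by rewrite mulrA divff ?uN0// mul1r.
  rewrite padic_absM padic_absV padic_absM !uN//.
  by rewrite ltr_pdivrMr ?mulr_gt0// uM.
rewrite -padic_piM -padic_pi1; apply/eqP/padic_eqP => e e0.
set v := insubd _ _; have vE : val v = fun n => (val u n)^-1 by exact: insubdK.
exists N => n /uN0 un0.
have -> : (val (v * u) - val (1 : padic_cauchy_seq p)) n = val v n * val u n - 1.
  by [].
by rewrite vE mulVf// subrr padic_abs0.
Qed.

Fact padic_invr0 : padic_inv 0 = 0.
Proof. by rewrite /padic_inv eqxx. Qed.

HB.instance Definition _ :=
  GRing.ComNzRing_isField.Build (padic p) padic_mulVf padic_invr0.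

(* The extension of [padic_abs] by continuity; it takes the same (rational)
   values as [padic_abs]. *)
Definition padic_norm x : rat := limn (fun n => abs (val (repr x) n) : rat^o).

Lemma padic_norm0 : padic_norm 0 = 0.
Proof.
apply: (@norm_cvg_lim _ rat^o); apply/cvgrPdist_lt => e e0.
have /eqP/padic_eq0P : pi (repr (0 : padic p)) = 0 by rewrite reprK.
move=> /(_ e e0)[N uN]; exists N => // n /= /uN.
by rewrite sub0r normrN ger0_norm// padic_abs_ge0.
Qed.

Lemma padic_norm_near u : pi u != 0 ->
  exists N, forall n, (N <= n)%N -> abs (val u n) = padic_norm (pi u).
Proof.
set x := pi u => x0.
have [r r0 [N vN]] : exists2 r, 0 < r &
    exists N, forall n, (N <= n)%N -> abs (val (repr x) n) = r.
  by apply: padic_neq0; rewrite reprK.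
have nx : padic_norm x = r.
  apply: (@norm_cvg_lim _ rat^o); apply/cvgrPdist_lt => e e0.
  by exists N => // n /= /vN ->; rewrite subrr normr0.
have /eqP/padic_eqP/(_ _ r0)[M uM] : pi u = pi (repr x) by rewrite reprK.
exists (maxn N M) => n; rewrite geq_max => /andP[/vN Nn /uM Mn].
by rewrite nx -Nn; apply: padic_absD_eq; rewrite Nn.
Qed.

Lemma padic_norm_gt0 x : (0 < padic_norm x) = (x != 0).
Proof.
have [->|] := eqVneq x 0; first by rewrite padic_norm0 ltxx.
rewrite -(reprK x) => x0.
have [r r0 [N rN]] := padic_neq0 x0; have [M uM] := padic_norm_near x0.
rewrite -(uM (maxn N M)) ?leq_maxr// rN ?leq_maxl//.
Qed.

Lemma padic_norm_ge0 x : 0 <= padic_norm x.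
Proof.
have [->|x0] := eqVneq x 0; first by rewrite padic_norm0.
by rewrite ltW// padic_norm_gt0.
Qed.

Lemma padic_norm_eq0 x : (padic_norm x == 0) = (x == 0).
Proof.
by apply/negb_inj; rewrite -padic_norm_gt0 lt_def padic_norm_ge0 andbT.
Qed.

Lemma padic_normM x y : padic_norm (x * y) = padic_norm x * padic_norm y.
Proof.
have [->|x0] := eqVneq x 0; first by rewrite mul0r padic_norm0 mul0r.
have [->|y0] := eqVneq y 0; first by rewrite mulr0 padic_norm0 mulr0.
have := mulf_neq0 x0 y0; move: x0 y0.
rewrite -(reprK x) -(reprK y) -padic_piM => x0 y0 xy0.
have [N uN] := padic_norm_near x0; have [M vM] := padic_norm_near y0.
have [K wK] := padic_norm_near xy0.
pose n := maxn K (maxn N M).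
rewrite -(wK n) ?leq_maxl// -(uN n) ?leq_max ?leqnn ?orbT//.
by rewrite -(vM n) ?leq_max ?leqnn ?orbT// -padic_absM.
Qed.

Lemma padic_normN x : padic_norm (- x) = padic_norm x.
Proof.
have [->|x0] := eqVneq x 0; first by rewrite oppr0.
have := x0; rewrite -oppr_eq0; move: x0; rewrite -(reprK x) -padic_piN => x0 nx0.
have [N uN] := padic_norm_near x0; have [M vM] := padic_norm_near nx0.
rewrite -(vM (maxn N M)) ?leq_maxr// -(uN (maxn N M)) ?leq_maxl//.
exact: padic_absN.
Qed.

Lemma padic_normD x y :
  padic_norm (x + y) <= Num.max (padic_norm x) (padic_norm y).
Proof.
have [->|x0] := eqVneq x 0; first by rewrite add0r le_max lexx orbT.
have [->|y0] := eqVneq y 0; first by rewrite addr0 le_max lexx.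
have [->|s0] := eqVneq (x + y) 0.
  by rewrite padic_norm0 le_max padic_norm_ge0.
move: x0 y0 s0; rewrite -(reprK x) -(reprK y) -padic_piD => x0 y0 s0.
have [N uN] := padic_norm_near x0; have [M vM] := padic_norm_near y0.
have [K wK] := padic_norm_near s0.
pose n := maxn K (maxn N M).
rewrite -(wK n) ?leq_maxl// -(uN n) ?leq_max ?leqnn ?orbT//.
rewrite -(vM n) ?leq_max ?leqnn ?orbT//; exact: padic_absD.
Qed.

Lemma padic_const_subproof (r : rat) : (fun=> r) \in padic_cauchy p.
Proof.
by apply/padic_cauchyP => e e0; exists 0%N => m n _ _; rewrite subrr padic_abs0.
Qed.

Definition padic_of_rat (r : rat) : padic p :=
  pi (PadicCauchySeq (padic_const_subproof r)).

Fact padic_of_rat_is_zmod_morphism : zmod_morphism padic_of_rat.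
Proof.
move=> r t; rewrite /padic_of_rat -padic_piN -padic_piD.
by congr (pi _); exact: val_inj.
Qed.

Fact padic_of_rat_is_monoid_morphism : monoid_morphism padic_of_rat.
Proof.
split=> [|r t]; rewrite /padic_of_rat -?padic_pi1 -?padic_piM;
  by congr (pi _); exact: val_inj.
Qed.

HB.instance Definition _ := GRing.isZmodMorphism.Build rat (padic p) padic_of_rat
  padic_of_rat_is_zmod_morphism.
HB.instance Definition _ := GRing.isMonoidMorphism.Build rat (padic p) padic_of_rat
  padic_of_rat_is_monoid_morphism.

Lemma ratr_padicE (r : rat) : ratr r = padic_of_rat r.
Proof. by rewrite (fmorph_eq_rat padic_of_rat). Qed.

Lemma padic_norm_ratr (r : rat) : padic_norm (ratr r : padic p) = abs r.
Proof.
rewrite ratr_padicE.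
have [->|r0] := eqVneq r 0; first by rewrite rmorph0 padic_norm0 padic_abs0.
have : padic_of_rat r != 0 by rewrite fmorph_eq0.
by move=> /padic_norm_near[N /(_ N (leqnn _))] <-.
Qed.

Definition padic_dist x y : rat := padic_norm (x - y).

Fact padic_distxx x : padic_dist x x = 0.
Proof. by rewrite /padic_dist subrr padic_norm0. Qed.

Fact padic_dist_positivity x y : padic_dist x y = 0 -> x = y.
Proof. by move=> /eqP; rewrite padic_norm_eq0 subr_eq0 => /eqP. Qed.

Fact padic_dist_sym x y : padic_dist x y = padic_dist y x.
Proof. by rewrite /padic_dist -padic_normN opprB. Qed.

Fact padic_dist_triangle y x z :
  padic_dist x z <= padic_dist x y + padic_dist y z.
Proof.
rewrite /padic_dist -[x in leLHS](subrK y) -addrA.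
apply: le_trans (padic_normD _ _) _.
by rewrite ge_max lerDl lerDr !padic_norm_ge0.
Qed.

HB.instance Definition _ := isPointed.Build (padic p) 0.
HB.instance Definition _ := @isMetric.Build rat (padic p) padic_dist
  padic_distxx padic_dist_positivity padic_dist_sym padic_dist_triangle.

End PadicField.

Section PadicLimits.
Variable p : prime_nat.
Implicit Types (x y l : padic p) (u : nat -> padic p).
Local Open Scope quotient_scope.

Lemma padic_cvgP u l :
  u @ \oo --> l <->
  forall e : rat, 0 < e -> exists N, forall n, (N <= n)%N ->
    padic_norm (u n - l) < e.
Proof.
split=> [/cvg_ballP ul e /ul[N _ uN]|ul].
  by exists N => n /uN /=; rewrite ballEmdist/= -padic_normN opprB.
apply/cvg_ballP => e /ul[N uN]; exists N => // n /= /uN.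
by rewrite ballEmdist/= -padic_normN opprB.
Qed.

Lemma padic_dense x (e : rat) : 0 < e ->
  exists r : rat, padic_norm (x - ratr r) < e.
Proof.
move=> e0; have [N uN] := padic_cauchyP _ _ (valP (repr x)) _ e0.
exists (val (repr x) N); rewrite ratr_padicE.
have [->|] := eqVneq (x - padic_of_rat p (val (repr x) N)) 0.
  by rewrite padic_norm0.
rewrite -{1 3}(reprK x) /padic_of_rat -padic_piN -padic_piD.
move=> /padic_norm_near[M /(_ (maxn N M) (leq_maxr _ _))] <-.
exact: uN (leq_maxl _ _) (leqnn _).
Qed.

Lemma padic_complete u :
  (forall e : rat, 0 < e -> exists N, forall m n, (N <= m)%N -> (N <= n)%N ->
    padic_norm (u m - u n) < e) ->
  exists l, u @ \oo --> l.
Proof.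
move=> cu.
have /choice[r rP] : forall n, exists r : rat,
    padic_norm (u n - ratr r) < n.+1%:R^-1.
  by move=> n; apply: padic_dense; rewrite invr_gt0 ltr0n.
have ur (e : rat) : 0 < e -> exists N, forall n, (N <= n)%N ->
    padic_norm (u n - ratr (r n)) < e.
  move=> e0; have [N _ NP] := near_infty_natSinv_lt (PosNum e0).
  by exists N => n /NP/= ne; exact: lt_trans (rP n) ne.
have cr : r \in padic_cauchy p.
  apply/padic_cauchyP => e e0; have [N uN] := cu _ e0; have [M rM] := ur _ e0.
  exists (maxn N M) => m n; rewrite !geq_max => /andP[Nm Mm] /andP[Nn Mn].
  rewrite -padic_norm_ratr.
  have -> : ratr (r m - r n) = ratr (r m) - ratr (r n) :> padic p.
    by rewrite !ratr_padicE rmorphB.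
  have -> : ratr (r m) - ratr (r n) =
      - (u m - ratr (r m)) + (u m - u n) + (u n - ratr (r n)) :> padic p.
    by rewrite opprB !addrA !subrK.
  rewrite (le_lt_trans (padic_normD _ _))// gt_max rM// andbT.
  by rewrite (le_lt_trans (padic_normD _ _))// gt_max padic_normN rM// uN.
exists (\pi_(padic p) (PadicCauchySeq cr)); apply/padic_cvgP => e e0.
have [N rN] := padic_cauchyP _ _ cr _ e0; have [M uM] := ur _ e0.
exists (maxn N M) => n; rewrite geq_max => /andP[Nn Mn].
rewrite -[u n](subrK (ratr (r n))) -addrA.
rewrite (le_lt_trans (padic_normD _ _))// gt_max uM//=.
rewrite ratr_padicE; set d := _ - _.
have [->|] := eqVneq d 0; first by rewrite padic_norm0.
rewrite /d /padic_of_rat -padic_piN -padic_piD.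
move=> /padic_norm_near[K /(_ (maxn N K) (leq_maxr _ _))] <-.
exact: rN Nn (leq_maxl _ _).
Qed.

End PadicLimits.

Definition pochhammer (x : rat) (n : nat) : rat := \prod_(i < n) (x + i%:R).

(* The p-adic sum of 2F0(alpha, 1 | z). *)
Definition padic_phi (p : prime_nat) (alpha : rat) (z : padic p) : padic p :=
  limn (series (fun n => ratr (pochhammer alpha n) * z ^+ n)).

(* Main.v *)
(** Expand a polynomial [F] in rising factorials, [F = \sum_l q_l (Y)_l]. Since
    [(x)_(h+l) = (x)_h (x+h)_l], the coefficients [q_l a^(N-l)] make
    [\sum_l q_l a^(N-l) phi(a)] equal to a rational number plus the remainder
    [\sum_h a^(N+h) (x)_h F(x+h)]. Taking for [F] a multiple, by a power of [Y] of
    exponent at most [m], of the polynomial with the roots [alpha_j + i], [i < n],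
    kills the first [n] terms of every remainder, so that for p not dividing [s]
    the approximation to a linear relation is p-adically at most
    [|a^(mn+n) n!^(m+1)|_p]; its denominator divides a power of [s] and its size is
    at most [C^n n!^m |a|^(mn)] up to a constant. A nonzero integer with such
    bounds contradicts the product formula under the limsup hypothesis.

    Some such [F] gives a nonzero value: the approximation is a linear form
    [lam] in [F] with [lam (F - a Y F(Y+1)) = - \sum_j l_j F(alpha_j)]. If [lam]
    vanished for all these [F], it would vanish on the whole ideal of the node
    polynomial, and the difference equation [F(x) - a x F(x+1) = f] can be solved
    on the nodes with prescribed [F(alpha_j)], forcing all [l_j = 0]. *)

Require Import Defs.
From mathcomp Require Import all_boot all_order all_algebra.
From mathcomp Require Import all_classical all_reals all_analysis.
From mathcomp Require Import ring lra zify.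

Set Implicit Arguments.
Unset Strict Implicit.
Unset Printing Implicit Defensive.

Import Order.TTheory GRing.Theory Num.Theory.
Import numFieldNormedType.Exports.

Local Open Scope classical_set_scope.
Local Open Scope ring_scope.

(** * Newton expansion in rising factorials *)

Definition rising (R : nzRingType) (l : nat) : {poly R} :=
  \prod_(i < l) ('X + (i%:R)%:P).

Lemma rising_monic (R : nzRingType) l : rising R l \is monic.
Proof. by apply: monic_prod => i _; exact: monicXaddC. Qed.

Lemma size_rising (R : idomainType) l : size (rising R l) = l.+1.
Proof.
rewrite /rising (eq_bigr (fun i : 'I_l => 'X - (- i%:R)%:P)); last first.
  by move=> i _; rewrite polyCN opprK.
by rewrite size_prod_XsubC /index_enum -enumT size_enum_ord.
Qed.

Lemma horner_rising (x : rat) l : (rising _ l).[x] = pochhammer x l.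
Proof. by rewrite horner_prod; apply: eq_bigr => i _; rewrite !hornerE. Qed.

Lemma map_rising l : map_poly intr (rising int l) = rising rat l.
Proof.
rewrite rmorph_prod/=; apply: eq_bigr => i _.
by rewrite rmorphD/= map_polyX map_polyC/= rmorph_nat.
Qed.

Lemma pochhammer0 x : pochhammer x 0 = 1.
Proof. by rewrite /pochhammer big_ord0. Qed.

Lemma pochhammerSr x l : pochhammer x l.+1 = pochhammer x l * (x + l%:R).
Proof. by rewrite /pochhammer big_ord_recr. Qed.

Lemma pochhammerSl x l : pochhammer x l.+1 = x * pochhammer (x + 1) l.
Proof.
rewrite /pochhammer big_ord_recl/= addr0; congr (_ * _).
by apply: eq_bigr => i _; rewrite /bump/= add1n -natr1 addrAC addrA.
Qed.

Lemma pochhammerD x l h :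
  pochhammer x (h + l) = pochhammer x h * pochhammer (x + h%:R) l.
Proof.
elim: l => [|l IH]; first by rewrite addn0 pochhammer0 mulr1.
by rewrite addnS !pochhammerSr IH natrD addrA mulrA.
Qed.

Lemma pochhammer00 l : pochhammer 0 l = (l == 0%N)%:R.
Proof. by case: l => [|l]; rewrite ?pochhammer0// pochhammerSl mul0r. Qed.

(** Backward rather than forward differences: they lower rising factorials, sending (y)_i to i
    (y)_(i-1), just as differentiation lowers powers. *)
Definition nabla (f : rat -> rat) (y : rat) := f y - f (y - 1).

(** The analogue of the Taylor coefficient at 0: every (y)_i with i > 0 vanishes at y = 0, so the
    l-th difference there isolates the coefficient of (y)_l. *)
Definition newton_coef (l : nat) (F : {poly rat}) : rat :=
  iter l nabla (horner F) 0 / l`!%:R.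

Lemma iter_nablaD l (f g : rat -> rat) (c : rat) y :
  iter l nabla (fun x => f x + c * g x) y =
  iter l nabla f y + c * iter l nabla g y.
Proof.
elim: l y => //= l IH y.
by rewrite /nabla !IH; ring.
Qed.

Lemma eq_iter_nabla l (f g : rat -> rat) : f =1 g ->
  iter l nabla f =1 iter l nabla g.
Proof. by move=> /funext ->. Qed.

Lemma newton_coefD l F G : newton_coef l (F + G) = newton_coef l F + newton_coef l G.
Proof.
rewrite /newton_coef -mulrDl; congr (_ / _).
rewrite (eq_iter_nabla _ (g := fun x => F.[x] + 1 * G.[x])); last first.
  by move=> x; rewrite hornerD mul1r.
by rewrite iter_nablaD mul1r.
Qed.

Lemma newton_coefZ l c F : newton_coef l (c *: F) = c * newton_coef l F.
Proof.
rewrite /newton_coef mulrA; congr (_ / _).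
rewrite (eq_iter_nabla _ (g := fun x => (0 : {poly rat}).[x] + c * F.[x])); last first.
  by move=> x; rewrite hornerZ horner0 add0r.
rewrite iter_nablaD [X in X + _](_ : _ = 0) ?add0r//.
have h y : iter l nabla (horner (0 : {poly rat})) y = 0.
  by elim: l y => [|l IH] y /=; rewrite ?horner0// /nabla !IH subrr.
exact: h.
Qed.

Lemma newton_coef0 l : newton_coef l 0 = 0.
Proof. by rewrite -[0](scale0r 0) newton_coefZ mul0r. Qed.

Lemma newton_coef_sum l I (r : seq I) (P : pred I) (F : I -> {poly rat}) :
  newton_coef l (\sum_(i <- r | P i) F i) =
  \sum_(i <- r | P i) newton_coef l (F i).
Proof. by apply: big_morph; [exact: newton_coefD|exact: newton_coef0]. Qed.

Lemma iter_nabla_rising l i y : iter l nabla (horner (rising _ i)) y =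
  (i ^_ l)%:R * pochhammer y (i - l).
Proof.
elim: l y => [|l IH] y /=; first by rewrite ffactn0 mul1r subn0 horner_rising.
rewrite /nabla !IH -mulrBr.
have [il|li] := leqP i l.
  rewrite (_ : (i - l = 0)%N); last by lia.
  by rewrite !pochhammer0 subrr mulr0 ffact_small ?mul0r.
rewrite (_ : (i - l = (i - l.+1).+1)%N); last by lia.
rewrite pochhammerSr pochhammerSl subrK ffactnSr natrM.
set q := pochhammer _ _; rewrite (_ : (i - l)%N = (i - l.+1).+1); last by lia.
by rewrite -[_.+1%:R]natr1; ring.
Qed.

Lemma newton_coef_rising l i : newton_coef l (rising _ i) = (l == i)%:R.
Proof.
rewrite /newton_coef iter_nabla_rising pochhammer00.
have [->|li] := eqVneq l i.
  by rewrite subnn eqxx mulr1 ffactnn divff// pnatr_eq0 -lt0n fact_gt0.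
have [l_lt|l_gt] := ltnP l i.
  by rewrite subn_eq0 leqNgt l_lt mulr0 mul0r.
by rewrite ffact_small ?mul0r// ltn_neqAle eq_sym li.
Qed.

(** Rising factorials are monic with integer coefficients, so leading terms can be removed one after
    another without any division. *)
Lemma rising_span_int (G : {poly int}) : exists c : nat -> int,
  map_poly intr G = \sum_(i < size G) (c i)%:~R *: rising rat i.
Proof.
have [d] := ubnP (size G); elim: d G => // d IH G /ltnSE sG.
have [->|G0] := eqVneq G 0.
  by exists (fun=> 0); rewrite size_poly0 big_ord0 map_poly0.
have sG0 : (0 < size G)%N by rewrite lt0n size_poly_eq0.
pose H := G - lead_coef G *: rising int (size G).-1.
have sH : (size H < size G)%N.
  rewrite -(prednK sG0) ltnS; apply/leq_sizeP => j.
  rewrite leq_eqVlt => /orP[/eqP <-|jG].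
    rewrite coefB coefZ.
    have := monicP (rising_monic int (size G).-1).
    by rewrite /lead_coef size_rising/= => ->; rewrite mulr1 subrr.
  rewrite coefB coefZ nth_default; last by rewrite -(prednK sG0).
  by rewrite nth_default ?mulr0 ?subr0// size_rising.
have [c Hc] := IH H (leq_trans sH sG).
(* The size of [H] may drop by more than one, and [c] is arbitrary beyond it; those entries are set
   to 0. *)
exists (fun i => if i == (size G).-1 then lead_coef G
                 else if (i < size H)%N then c i else 0).
have -> : G = H + lead_coef G *: rising int (size G).-1 by rewrite subrK.
rewrite rmorphD/= Hc map_polyZ map_rising subrK.
rewrite -[in RHS](prednK sG0) big_ord_recr/= eqxx; congr (_ + _).
rewrite (big_ord_widen (size G).-1 (fun i : nat => (c i)%:~R *: rising rat i))//=.
  rewrite big_mkcond/=; apply: eq_bigr => i _; rewrite ltn_eqF ?ltn_ord//.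
  by case: ifP; rewrite ?scale0r.
by rewrite -ltnS prednK.
Qed.

(** The division by [l!] introduces no denominator on integer polynomials. Both the denominator
    bound and the p-adic bound rest on this. *)
Lemma newton_coef_int (G : {poly int}) l : exists z : int,
  newton_coef l (map_poly intr G) = z%:~R.
Proof.
have [c ->] := rising_span_int G; rewrite newton_coef_sum.
under eq_bigr do
  rewrite newton_coefZ newton_coef_rising -[_%:R]/(((_ : nat)%:Z)%:~R) -intrM.
by rewrite -rmorph_sum/=; eexists.
Qed.

Lemma newton_expansion (F : {poly rat}) D : (size F <= D)%N ->
  F = \sum_(l < D) newton_coef l F *: rising _ l.
Proof.
move=> sFD.
(* By [newton_coef_rising] the coefficients of any expansion are forced, so existence suffices;
   clearing denominators reduces it to integer polynomials. *)
suff [c FE] : exists c : nat -> rat, F = \sum_(l < D) c l *: rising _ l.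
  rewrite {1}FE; apply: eq_bigr => i _; congr (_ *: _).
  rewrite FE newton_coef_sum (bigD1 i)//= newton_coefZ newton_coef_rising.
  rewrite eqxx mulr1 big1 ?addr0// => j ji.
  by rewrite newton_coefZ newton_coef_rising eq_sym val_eqE (negbTE ji) mulr0.
have [G [b b0 FE]] := rat_poly_scale F.
have [c Gc] := rising_span_int G.
have sG : (size G <= D)%N.
  move: sFD; rewrite FE size_scale ?invr_eq0 ?intr_eq0// size_map_inj_poly//.
  exact: intr_inj.
exists (fun l => if (l < size G)%N then b%:~R^-1 * (c l)%:~R else 0).
rewrite FE Gc scaler_sumr.
rewrite (big_ord_widen D (fun i : nat => b%:~R^-1 *: ((c i)%:~R *: rising rat i)))//=.
rewrite big_mkcond/=; apply: eq_bigr => i _.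
by case: ifP; rewrite ?scale0r// scalerA.
Qed.

Lemma newton_coef_ge_size (F : {poly rat}) l : (size F <= l)%N ->
  newton_coef l F = 0.
Proof.
move=> sF; rewrite [F](newton_expansion sF) newton_coef_sum big1// => i _.
by rewrite newton_coefZ newton_coef_rising gtn_eqF ?mulr0.
Qed.

(** * Nonvanishing *)

(** The linear form on polynomials that takes the value [v l] on the basis element (Y)_l. *)
Definition newton_form (v : nat -> rat) (F : {poly rat}) : rat :=
  \sum_(l < size F) newton_coef l F * v l.

Lemma newton_formE v (F : {poly rat}) D : (size F <= D)%N ->
  newton_form v F = \sum_(l < D) newton_coef l F * v l.
Proof.
move=> sF; rewrite /newton_form.
rewrite (big_ord_widen D (fun l : nat => newton_coef l F * v l))// big_mkcond/=.
apply: eq_bigr => l _; case: ltnP => // /newton_coef_ge_size ->.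
by rewrite mul0r.
Qed.

Lemma newton_formD v (F G : {poly rat}) :
  newton_form v (F + G) = newton_form v F + newton_form v G.
Proof.
pose D := maxn (size F) (size G).
rewrite !(@newton_formE _ _ D) ?leq_maxl ?leq_maxr ?size_polyD//.
rewrite -big_split/=; apply: eq_bigr => l _.
by rewrite newton_coefD mulrDl.
Qed.

Lemma newton_formZ v c (F : {poly rat}) : newton_form v (c *: F) = c * newton_form v F.
Proof.
rewrite !(@newton_formE _ _ (size F)) ?size_scale_leq// mulr_sumr.
by apply: eq_bigr => l _; rewrite newton_coefZ -mulrA.
Qed.

Lemma newton_form0 v : newton_form v 0 = 0.
Proof. by rewrite -[0](scale0r 0) newton_formZ mul0r. Qed.

Lemma newton_formB v (F G : {poly rat}) :
  newton_form v (F - G) = newton_form v F - newton_form v G.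
Proof. by rewrite newton_formD -scaleN1r newton_formZ mulN1r. Qed.

Lemma newton_form_sum v I (r : seq I) (P : pred I) (F : I -> {poly rat}) :
  newton_form v (\sum_(i <- r | P i) F i) =
  \sum_(i <- r | P i) newton_form v (F i).
Proof. by apply: big_morph; [exact: newton_formD|exact: newton_form0]. Qed.

Lemma newton_form_rising v l : newton_form v (rising _ l) = v l.
Proof.
rewrite /newton_form size_rising big_ord_recr/= newton_coef_rising eqxx mul1r.
rewrite big1 ?add0r// => i _.
by rewrite newton_coef_rising ltn_eqF ?mul0r.
Qed.

Lemma rising_shift l : 'X * (rising rat l \Po ('X + 1)) = rising rat l.+1.
Proof.
rewrite /rising big_ord_recl addr0; congr (_ * _).
rewrite rmorph_prod/=; apply: eq_bigr => i _.
rewrite comp_polyD comp_polyX comp_polyC /bump/= add1n -natr1 polyCD.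
by rewrite addrAC addrA.
Qed.

(** Since Y (Y+1)_l = (Y)_(l+1), this operator sends (Y)_l to (Y)_l - a (Y)_(l+1). It is thus the
    transpose of the recurrence [v l - a * v l.+1] on sequences. *)
Definition shift_op (a : rat) (F : {poly rat}) : {poly rat} :=
  F - a *: ('X * (F \Po ('X + 1))).

Lemma newton_form_shift_op (a : rat) (v w : nat -> rat) F :
  (forall l, v l - a * v l.+1 = w l) ->
  newton_form v (shift_op a F) = newton_form w F.
Proof.
move=> vw.
have -> : shift_op a F =
    \sum_(l < size F) newton_coef l F *: (rising _ l - a *: rising _ l.+1).
  rewrite /shift_op {1 2}(newton_expansion (leqnn (size F))).
  rewrite raddf_sum/= mulr_sumr scaler_sumr -sumrB.
  apply: eq_bigr => l _; rewrite comp_polyZ -scalerAr rising_shift.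
  by rewrite scalerBr !scalerA mulrC.
rewrite newton_form_sum; apply: eq_bigr => l _.
by rewrite newton_formZ newton_formB newton_formZ !newton_form_rising vw.
Qed.

Lemma newton_form_horner x F : newton_form (pochhammer x) F = F.[x].
Proof.
rewrite [in RHS](newton_expansion (leqnn (size F))) horner_sum.
by apply: eq_bigr => l _; rewrite hornerZ horner_rising.
Qed.

(** * Node polynomials and the ideals they generate *)

Definition node_poly m (alpha : 'I_m -> rat) (n : nat) : {poly rat} :=
  \prod_(j < m) \prod_(i < n) ('X - (alpha j + i%:R)%:P).

Lemma horner_node_poly m (alpha : 'I_m -> rat) n x :
  (node_poly alpha n).[x] = \prod_(j < m) \prod_(i < n) (x - (alpha j + i%:R)).
Proof.
rewrite horner_prod; apply: eq_bigr => j _.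
by rewrite horner_prod; apply: eq_bigr => i _; rewrite !hornerE.
Qed.

Lemma node_poly_monic m (alpha : 'I_m -> rat) n : node_poly alpha n \is monic.
Proof. by do 2!apply: monic_prod => ? _; exact: monicXsubC. Qed.

Lemma node_poly_root m (alpha : 'I_m -> rat) n (j : 'I_m) i : (i < n)%N ->
  (node_poly alpha n).[alpha j + i%:R] = 0.
Proof.
move=> i_n; rewrite horner_node_poly (bigD1 j)//= (bigD1 (Ordinal i_n))//=.
by rewrite subrr !mul0r.
Qed.

Lemma node_polyS m (alpha : 'I_m -> rat) n :
  node_poly alpha n.+1 =
  node_poly alpha n * \prod_(j < m) ('X - (alpha j + n%:R)%:P).
Proof.
rewrite /node_poly -big_split/=; apply: eq_bigr => j _.
by rewrite big_ord_recr.
Qed.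

(** The shift moves the nodes alpha_j, ..., alpha_j + n down by one, and the first n nodes of each
    progression remain among them. Hence [shift_op] maps multiples of [node_poly alpha n.+1] to
    multiples of [node_poly alpha n]. *)
Lemma node_polyS_shift m (alpha : 'I_m -> rat) n :
  node_poly alpha n.+1 \Po ('X + 1) =
  node_poly alpha n * \prod_(j < m) ('X - (alpha j - 1)%:P).
Proof.
rewrite /node_poly -big_split/= rmorph_prod/=; apply: eq_bigr => j _.
rewrite rmorph_prod/= big_ord_recl [LHS]mulrC; congr (_ * _).
  apply: eq_bigr => i _; rewrite comp_polyB comp_polyX comp_polyC.
  by rewrite /= /bump/= add1n -natr1 !polyCD; ring.
by rewrite comp_polyB comp_polyX comp_polyC addr0 polyCB; ring.
Qed.

Lemma size_node_poly m (alpha : 'I_m -> rat) n :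
  size (node_poly alpha n) = (m * n).+1.
Proof.
rewrite /node_poly pair_bigA/= size_prod_XsubC.
by rewrite /index_enum -enumT -cardE card_prod !card_ord.
Qed.

(** Lagrange interpolation, with [b t u] as the linear factors of the basis polynomials. *)
Lemma interpolation (T : finType) (x w : T -> rat) : injective x ->
  exists F : {poly rat}, forall t, F.[x t] = w t.
Proof.
move=> x_inj; pose b t u := (x t - x u)^-1 *: ('X - (x u)%:P).
exists (\sum_t w t *: \prod_(u | u != t) b t u) => t.
rewrite horner_sum (bigD1 t)//= [X in _ + X]big1 ?addr0.
  rewrite hornerZ horner_prod big1 ?mulr1// => u ut.
  by rewrite !hornerE mulVf// subr_eq0 (inj_eq x_inj) eq_sym.
move=> u ut; rewrite hornerZ horner_prod (bigD1 t) 1?eq_sym//=.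
by rewrite !hornerE /= subrr mulr0 mul0r.
Qed.

(** Descent on the degree of g. The form vanishes on [shift_op a (node_poly alpha n.+1 * h)], which
    has the form [node_poly alpha n * G] with deg G = deg h + m + 1; subtracting such a G removes
    the leading term of g as soon as deg g > m. *)
Lemma newton_form_ideal0 m (alpha : 'I_m -> rat) n (a : rat) (v : nat -> rat)
    (lc : 'I_m -> rat) : a != 0 ->
  (forall F, newton_form v (shift_op a F) = - \sum_(j < m) lc j * F.[alpha j]) ->
  (forall k, (k <= m)%N -> newton_form v (node_poly alpha n * 'X^k) = 0) ->
  forall g : {poly rat}, newton_form v (node_poly alpha n * g) = 0.
Proof.
move=> a0 vshift vk g.
have [d] := ubnP (size g); elim: d g => // d IH g /ltnSE sg.
have [gm|mg] := leqP (size g) m.+1.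
  rewrite -(coefK g) poly_def mulr_sumr newton_form_sum big1// => i _.
  by rewrite -scalerAr newton_formZ vk ?mulr0// -ltnS (leq_trans _ gm).
pose e := (size g - m.+2)%N.
have sgE : size g = (m.+2 + e)%N by rewrite subnKC.
(* The leading term of G comes from - a Y V h(Y+1), so its coefficient is - a c; this choice makes
   it equal to that of g. *)
pose c := - (lead_coef g / a).
pose h : {poly rat} := c *: 'X^e.
pose U : {poly rat} := \prod_(j < m) ('X - (alpha j + n%:R)%:P).
pose V : {poly rat} := \prod_(j < m) ('X - (alpha j - 1)%:P).
pose G : {poly rat} := U * h - a *: ('X * V * (h \Po ('X + 1))).
have GE : node_poly alpha n * G = shift_op a (node_poly alpha n.+1 * h).
  rewrite /shift_op node_polyS rmorphM/= -node_polyS node_polyS_shift -/U -/V /G.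
  rewrite node_polyS -/U -!mul_polyC; ring.
have G0 : newton_form v (node_poly alpha n * G) = 0.
  (* With n+1 nodes per progression, alpha_j itself is always a root, even for n = 0. *)
  rewrite GE vshift big1 ?oppr0// => j _.
  by rewrite hornerM -[alpha j]addr0 (@node_poly_root _ _ _ _ 0)// mul0r mulr0.
have sU : size U = m.+1.
  by rewrite size_prod_XsubC /index_enum -enumT size_enum_ord.
have Vm : V \is monic by apply: monic_prod => ? _; exact: monicXsubC.
have sV : size V = m.+1.
  by rewrite size_prod_XsubC /index_enum -enumT size_enum_ord.
rewrite -[g](subrK G) mulrDr newton_formD G0 addr0 IH//.
pose Y : {poly rat} := 'X * V * ('X + 1) ^+ e.
have X1 : ('X + 1 : {poly rat}) \is monic by rewrite -[1]/(1%:P); exact: monicXaddC.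
have Ym : Y \is monic by rewrite !rpredM// ?monicX// rpredX.
have sY : size Y = (m.+2 + e)%N.
  rewrite /Y size_Mmonic ?monic_neq0 ?rpredX// ?rpredM ?monicX//.
  rewrite mulrC size_mulX ?monic_neq0// sV.
  have -> : size (('X + 1 : {poly rat}) ^+ e) = e.+1.
    by rewrite -[1]/(1%:P) -[1]opprK polyCN size_exp_XsubC.
  by rewrite addnS.
have GE2 : G = U * h + lead_coef g *: Y.
  congr (_ + _); rewrite /h comp_polyZ comp_Xn_poly /Y -scalerAr scalerA /c mulrN.
  by rewrite mulrCA divff// mulr1 scaleNr opprK.
apply: leq_trans sg; rewrite sgE addSn ltnS; apply/leq_sizeP => i.
have sUh : (size (U * h)%R <= m.+1 + e)%N.
  apply: leq_trans (size_polyMleq _ _) _; rewrite sU addSn/=.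
  apply: leq_trans (leq_add (leqnn _) (size_scale_leq _ _)) _.
  by rewrite size_polyXn addnS.
move=> ei; rewrite GE2 coefB coefD coefZ (nth_default 0 (leq_trans sUh ei)) add0r.
move: ei; rewrite leq_eqVlt => /orP[/eqP <-|ei].
  have Y1 : Y`_(m.+1 + e) = 1 by move/monicP: Ym; rewrite /lead_coef sY.
  by rewrite Y1 mulr1 /lead_coef sgE subrr.
by rewrite !nth_default ?sY ?sgE// mulr0 subr0.
Qed.

Lemma node_inj m (alpha : 'I_m -> rat) n :
  (forall i j : 'I_m, i <> j -> alpha i - alpha j \isn't a Num.int) ->
  injective (fun t : 'I_m * 'I_n => alpha t.1 + (t.2 : nat)%:R).
Proof.
move=> alpha_diff [i k] [j l] /= ijE.
have ij : i = j.
  apply: contrapT => /alpha_diff/negP; apply.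
  have -> : alpha i - alpha j = (l : nat)%:R - (k : nat)%:R.
    by lra.
  by rewrite rpredB// natr_int.
move: ijE; rewrite ij => /addrI/eqP; rewrite eqr_nat => /eqP kl.
by congr (_, _); exact: val_inj.
Qed.

(* The difference equation [F x - a x F (x + 1) = f] can be solved forward along
   each progression [alpha j, alpha j + 1, ...], starting from any value. *)
Lemma shift_op_interpolation m (alpha : 'I_m -> rat) n (a f : rat) (b : 'I_m -> rat) :
  a != 0 ->
  (forall (j : 'I_m) (k : nat), alpha j <> - k%:R) ->
  (forall i j : 'I_m, i <> j -> alpha i - alpha j \isn't a Num.int) ->
  exists F g : {poly rat}, (forall j, F.[alpha j] = b j) /\
    shift_op a F = f%:P + node_poly alpha n * g.
Proof.
move=> a0 alpha_nonpos alpha_diff.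
pose w (j : 'I_m) := fix w i := if i is i'.+1
  then (w i' - f) / (a * (alpha j + i'%:R)) else b j.
(* Values are prescribed for indices up to n, one more than the n nodes where the equation is
   imposed, since the equation at index i involves the value at index i + 1. *)
have [F FE] := interpolation (fun t : 'I_m * 'I_n.+1 => w t.1 t.2)
  (@node_inj _ _ n.+1 alpha_diff).
exists F.
have Fw j i : (i <= n)%N -> F.[alpha j + i%:R] = w j i.
  by rewrite -ltnS => i_n; rewrite -(FE (j, Ordinal i_n)).
have [g gE] : exists g, shift_op a F - f%:P = g * node_poly alpha n.
  apply/dvdpP; rewrite /node_poly pair_bigA/=.
  pose x (t : 'I_m * 'I_n) := alpha t.1 + (t.2 : nat)%:R.
  rewrite -(big_map x predT (fun z => 'X - z%:P)).
  apply: uniq_roots_dvdp; last first.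
    by rewrite uniq_rootsE map_inj_uniq ?index_enum_uniq//; exact: node_inj.
  apply/allP => _ /mapP[[j i] _ ->].
  have x1 : x (j, i) + 1 = alpha j + (i.+1)%:R by rewrite /x -addrA natr1.
  rewrite rootE /shift_op !hornerE horner_comp !hornerE /= x1 /x/=.
  rewrite !Fw ?ltn_ord 1?ltnW//=; apply/eqP.
  (* The recursion for [w] divides by a (alpha_j + i); this is where nonpositive integers must be
     excluded. *)
  have ai0 : alpha j + (i : nat)%:R != 0.
    by apply/eqP => /eqP; rewrite addr_eq0 => /eqP; exact: alpha_nonpos.
  by field; rewrite ai0.
exists g; split=> [j|]; last by rewrite mulrC -gE addrC subrK.
by rewrite -[alpha j]addr0 (Fw j 0).
Qed.

(** * The linear form attached to a relation *)

Definition phi_psum (x a : rat) (l : nat) : rat :=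
  \sum_(i < l) pochhammer x i * a ^+ i.

(** The relation truncated after l terms, scaled by a^(-l): with this scaling the difference
    [v l - a * v l.+1] keeps only the term of index l, free of powers of a. *)
Definition relation_coef m (alpha : 'I_m -> rat) (a l0 : rat) (lc : 'I_m -> rat)
    (l : nat) : rat :=
  a ^- l * (l0 + \sum_(j < m) lc j * phi_psum (alpha j) a l).

Lemma relation_coef_rec m (alpha : 'I_m -> rat) (a l0 : rat) (lc : 'I_m -> rat) l :
  a != 0 ->
  relation_coef alpha a l0 lc l - a * relation_coef alpha a l0 lc l.+1 =
  - \sum_(j < m) lc j * pochhammer (alpha j) l.
Proof.
move=> a0; rewrite /relation_coef /phi_psum.
under [X in _ - a * (_ * (_ + X))]eq_bigr do rewrite big_ord_recr mulrDr/=.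
rewrite big_split/= exprS invfM.
under [X in _ - a * (_ * (_ + (_ + X)))]eq_bigr do rewrite mulrA.
rewrite -mulr_suml; set S := \sum_(i < m) lc i * pochhammer _ _.
set T := \sum_(i < m) _.
have al0 : a ^+ l != 0 by rewrite expf_neq0.
by field; rewrite a0 al0.
Qed.

(** Used in contrapositive form: for every n, a nontrivial relation has a nonzero approximation for
    some k <= m. *)
Lemma newton_form_relation_eq0 m (alpha : 'I_m -> rat) n (a l0 : rat)
    (lc : 'I_m -> rat) : a != 0 ->
  (forall (j : 'I_m) (k : nat), alpha j <> - k%:R) ->
  (forall i j : 'I_m, i <> j -> alpha i - alpha j \isn't a Num.int) ->
  (forall k, (k <= m)%N ->
    newton_form (relation_coef alpha a l0 lc) (node_poly alpha n * 'X^k) = 0) ->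
  l0 = 0 /\ forall j, lc j = 0.
Proof.
move=> a0 alpha_nonpos alpha_diff vk; set v := relation_coef _ _ _ _ in vk.
have vshift F :
    newton_form v (shift_op a F) = - \sum_(j < m) lc j * F.[alpha j].
  rewrite (newton_form_shift_op _ (fun l => relation_coef_rec alpha l0 lc l a0)).
  rewrite /newton_form; under eq_bigr do rewrite mulrN mulr_sumr.
  rewrite sumrN exchange_big/=; congr (- _); apply: eq_bigr => j _.
  rewrite -newton_form_horner mulr_sumr; apply: eq_bigr => l _; ring.
have videal := newton_form_ideal0 a0 vshift vk.
have v1 : newton_form v 1 = l0.
  have -> : 1 = rising rat 0 by rewrite /rising big_ord0.
  rewrite newton_form_rising /v /relation_coef expr0 invr1 mul1r big1 ?addr0//.
  by move=> j _; rewrite /phi_psum big_ord0 mulr0.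
split.
  (* Here F vanishes at all alpha_j and [shift_op a F] is 1 modulo the ideal, so the form takes the
     value 0 at 1, and that value is l0. *)
  have [F [g [Fb Fg]]] :=
    shift_op_interpolation n 1 (fun=> 0) a0 alpha_nonpos alpha_diff.
  have := vshift F; rewrite Fg newton_formD videal addr0 v1 => ->.
  by rewrite big1 ?oppr0// => j _; rewrite Fb mulr0.
(* Here F is 1 at alpha_j and 0 at the other alpha_k, while [shift_op a F] lies in the ideal; this
   isolates [lc j]. *)
move=> j; have [F [g [Fb Fg]]] :=
  shift_op_interpolation n 0 (fun k => (k == j)%:R) a0 alpha_nonpos alpha_diff.
have := vshift F; rewrite Fg newton_formD videal newton_form0 addr0.
rewrite (bigD1 j)//= Fb eqxx mulr1 big1 ?addr0.
  by move/eqP; rewrite eq_sym oppr_eq0 => /eqP.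
by move=> k kj; rewrite Fb (negbTE kj) mulr0.
Qed.

(** * Denominators and archimedean size *)

Lemma pochhammer_int_scale (s : nat) (x : rat) i : s%:R * x \is a Num.int ->
  s%:R ^+ i * pochhammer x i \is a Num.int.
Proof.
move=> sx; elim: i => [|i IH]; first by rewrite expr0 pochhammer0 mulr1.
rewrite exprSr pochhammerSr mulrACA rpredM// mulrDr rpredD//.
by rewrite -natrM natr_int.
Qed.

Lemma node_poly_int_scale m (alpha : 'I_m -> rat) (s n k : nat) :
  (forall j, s%:R * alpha j \is a Num.int) ->
  exists G : {poly int},
    s%:R ^+ (m * n) *: (node_poly alpha n * 'X^k) = map_poly intr G.
Proof.
move=> salpha.
have /choice[z zE] : forall j, exists z : int, s%:R * alpha j = z%:~R.
  by move=> j; exact/intrP.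
exists ((\prod_(j < m) \prod_(i < n) (s%:R *: 'X - (z j + s%:R * i%:R)%:P)) * 'X^k).
rewrite rmorphM/= map_polyXn scalerAl; congr (_ * _).
rewrite rmorph_prod/= /node_poly -[LHS]mul_polyC rmorphXn/=.
have -> : (s%:R%:P : {poly rat}) ^+ (m * n) =
    \prod_(j < m) \prod_(i < n) s%:R%:P.
  under eq_bigr do rewrite prodr_const card_ord.
  by rewrite prodr_const card_ord -exprM mulnC.
rewrite -big_split/=; apply: eq_bigr => j _.
rewrite -big_split/= rmorph_prod/=; apply: eq_bigr => i _.
rewrite rmorphB/= map_polyZ map_polyX map_polyC/= intrD intrM -zE !mulrz_nat.
by rewrite mulrBr mul_polyC -polyCM mulrDr.
Qed.

(** The last term of the partial sum has index l - 1 <= N, so s^N already clears every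
    denominator. *)
Lemma phi_psum_int_scale (s N l : nat) (a : int) (x : rat) :
  s%:R * x \is a Num.int -> (l <= N.+1)%N ->
  s%:R ^+ N * phi_psum x a%:~R l \is a Num.int.
Proof.
move=> sx lN; rewrite mulr_sumr rpred_sum// => i _.
have iN : (i <= N)%N by rewrite -ltnS (leq_trans (ltn_ord i)).
rewrite mulrA rpredM ?rpredX ?intr_int//.
rewrite -(subnK iN) exprD -mulrA rpredM ?rpredX ?natr_int//.
exact: pochhammer_int_scale.
Qed.

(** This is a^N times the form of the relation, written with a^(N-l) in place of negative powers of
    a, so that an integer a contributes no denominator. *)
Definition approximant m (alpha : 'I_m -> rat) (a l0 : rat) (lc : 'I_m -> rat)
    (N : nat) (F : {poly rat}) : rat :=
  \sum_(l < N.+1) newton_coef l F * a ^+ (N - l) *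
    (l0 + \sum_(j < m) lc j * phi_psum (alpha j) a l).

Lemma approximantE m (alpha : 'I_m -> rat) (a l0 : rat) lc N (F : {poly rat}) : a != 0 ->
  (size F <= N.+1)%N ->
  approximant alpha a l0 lc N F =
  a ^+ N * newton_form (relation_coef alpha a l0 lc) F.
Proof.
move=> a0 sF; rewrite (newton_formE _ sF) mulr_sumr; apply: eq_bigr => l _.
have lN : (l <= N)%N by rewrite -ltnS.
have aN : a ^+ N = a ^+ (N - l) * a ^+ l by rewrite -exprD subnK.
rewrite /relation_coef aN.
have al0 : a ^+ l != 0 by rewrite expf_neq0.
by field.
Qed.

Lemma size_node_polyXn m (alpha : 'I_m -> rat) n k : (k <= m)%N ->
  (size (node_poly alpha n * 'X^k)%R <= (m * n + m).+1)%N.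
Proof.
move=> km; rewrite size_mulXn ?monic_neq0 ?node_poly_monic//.
by rewrite size_node_poly addnS addnC ltnS leq_add2l.
Qed.

Lemma approximant_int m (alpha : 'I_m -> rat) (s n k N : nat) (a l0 : int)
    (lc : 'I_m -> int) : (forall j, s%:R * alpha j \is a Num.int) ->
  s%:R ^+ (m * n + N) *
  approximant alpha a%:~R l0%:~R (fun j => (lc j)%:~R) N (node_poly alpha n * 'X^k)
  \is a Num.int.
Proof.
move=> salpha; rewrite mulr_sumr rpred_sum// => l _.
set F := node_poly _ _ * _; set S := \sum_(j < m) _.
have -> : s%:R ^+ (m * n + N) * (newton_coef l F * a%:~R ^+ (N - l) * (l0%:~R + S)) =
  (s%:R ^+ (m * n) * newton_coef l F) * a%:~R ^+ (N - l) * (s%:R ^+ N * (l0%:~R + S)).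
  by rewrite exprD; ring.
apply: rpredM; first (apply: rpredM; last by rewrite rpredX ?intr_int).
  rewrite -newton_coefZ; have [G ->] := node_poly_int_scale n k salpha.
  by have [z ->] := newton_coef_int G l; rewrite intr_int.
rewrite mulrDr rpredD//; first by rewrite rpredM ?rpredX ?natr_int ?intr_int.
rewrite /S mulr_sumr rpred_sum// => j _; rewrite mulrCA rpredM ?intr_int//.
by apply: phi_psum_int_scale => //; exact: ltnW.
Qed.

Lemma normr_pochhammer (K : nat) (x : rat) i : (0 < K)%N -> `|x| <= K%:R ->
  `|pochhammer x i| <= K%:R ^+ i * i`!%:R.
Proof.
move=> K0 xK; elim: i => [|i IH]; first by rewrite pochhammer0 normr1 mulr1.
rewrite pochhammerSr normrM exprSr factS mulnC natrM mulrACA.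
apply: ler_pM => //.
apply: le_trans (ler_normD _ _) _; rewrite normr_nat.
rewrite -natrM mulnS natrD lerD// ler_nat.
by rewrite leq_pmull.
Qed.

Lemma normr_iter_nabla l (f : rat -> rat) (B y : rat) :
  (forall k, (k <= l)%N -> `|f (y - k%:R)| <= B) ->
  `|iter l nabla f y| <= 2 ^+ l * B.
Proof.
elim: l y => [|l IH] y fB /=; first by have := fB 0 (leqnn _); rewrite subr0 mul1r.
rewrite /nabla exprS -mulrA mulr_natl mulr2n.
apply: le_trans (ler_normB _ _) _; apply: lerD; apply: IH => k kl.
  by apply: fB; exact: leqW.
by rewrite -addrA -opprD nat1r; exact: fB.
Qed.

Lemma normr_newton_coef l F B :
  (forall k, (k <= l)%N -> `|F.[- k%:R]| <= B) ->
  `|newton_coef l F| <= 2 ^+ l * B / l`!%:R.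
Proof.
move=> FB; rewrite normrM normfV normr_nat ler_wpM2r ?invr_ge0//.
by apply: normr_iter_nabla => k kl; rewrite sub0r; exact: FB.
Qed.

Lemma dvdn_fact_fact k n : (k <= n)%N -> (k`! %| n`!)%N.
Proof. by move=> /bin_fact <-; rewrite mulnCA dvdn_mulr. Qed.

Lemma bin_leq_2exp n k : ('C(n, k) <= 2 ^ n)%N.
Proof.
have [nk|kn] := ltnP n k; first by rewrite bin_small.
rewrite -[2%N]/(1 + 1)%N expnDn (bigD1 (Ordinal (kn : (k < n.+1)%N)))//=.
by rewrite !exp1n !muln1 leq_addr.
Qed.

Lemma prod_addS_fact M n : (\prod_(i < n) (M + i).+1 = 'C(M + n, n) * n`!)%N.
Proof.
have E : (\prod_(i < n) (M + i).+1 * M`! = (M + n)`!)%N.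
  elim: n => [|n IH]; first by rewrite big_ord0 mul1n addn0.
  by rewrite big_ord_recr/= addnS factS -IH mulnAC mulnC.
apply/eqP; rewrite -(eqn_pmul2r (fact_gt0 M)) E -mulnA.
by have := bin_fact (leq_addl M n); rewrite addnK => ->.
Qed.

Lemma prod_add_leq M n : (\prod_(i < n) (M + i) <= 2 ^ (M + n) * n`!)%N.
Proof.
apply: (@leq_trans ('C(M + n, n) * n`!)); last by rewrite leq_mul2r bin_leq_2exp orbT.
by rewrite -prod_addS_fact; apply: leq_prod => i _.
Qed.

(** Newton coefficients sample a polynomial only at 0, -1, -2, ..., hence the argument -k. For each
    j the factors are at most K + N + i, and their product is at most a binomial coefficient times
    n!. *)
Lemma normr_node_poly m (alpha : 'I_m -> rat) (K N n k : nat) :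
  (forall j, `|alpha j| <= K%:R) -> (k <= N)%N ->
  `|(node_poly alpha n).[- k%:R]| <= (2 ^ (K + N + n) * n`!)%N%:R ^+ m.
Proof.
move=> alphaK kN; rewrite horner_node_poly normr_prod.
have -> : forall x : rat, x ^+ m = \prod_(j < m) x.
  by move=> x; rewrite prodr_const card_ord.
apply: ler_prod => j _; rewrite normr_ge0/= normr_prod.
apply: (@le_trans _ _ (\prod_(i < n) (K + N + i)%N%:R)).
  apply: ler_prod => i _; rewrite normr_ge0/= -opprD normrN.
  rewrite addrA natrD; apply: le_trans (ler_normD _ _) _.
  rewrite normr_nat lerD2r addrC natrD; apply: le_trans (ler_normD _ _) _.
  by rewrite normr_nat lerD// ler_nat.
by rewrite -natr_prod ler_nat prod_add_leq.
Qed.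

Lemma normr_phi_psum (K : nat) (x a : rat) l : (0 < K)%N -> `|x| <= K%:R ->
  1 <= `|a| ->
  `|phi_psum x a l| <= l%:R * (K%:R ^+ l * l`!%:R * `|a| ^+ l).
Proof.
move=> K0 xK a1; apply: le_trans (ler_norm_sum _ _ _) _.
have -> : l%:R * (K%:R ^+ l * l`!%:R * `|a| ^+ l) =
    \sum_(i < l) (K%:R ^+ l * l`!%:R * `|a| ^+ l).
  by rewrite sumr_const card_ord mulr_natl.
apply: ler_sum => i _; rewrite normrM normrX.
have il := ltnW (ltn_ord i).
apply: ler_pM => //; last by rewrite ler_weXn2l.
apply: le_trans (normr_pochhammer _ K0 xK) _.
apply: ler_pM; rewrite ?ler_weXn2l ?ler1n ?ler_nat ?exprn_ge0//.
by rewrite dvdn_leq ?fact_gt0 ?dvdn_fact_fact.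
Qed.

(** Origin of 8 K: a factor 2 from the iterated differences, 2 from l + 1 <= 2^l, K from the
    Pochhammer symbols, and 2 from the number N + 1 <= 2^N of terms. *)
Lemma normr_approximant m (alpha : 'I_m -> rat) (K N n k : nat) (a l0 : rat)
    (lc : 'I_m -> rat) : (0 < K)%N -> (forall j, `|alpha j| <= K%:R) ->
  1 <= `|a| -> (k <= m)%N ->
  `|approximant alpha a l0 lc N (node_poly alpha n * 'X^k)| <=
  (`|l0| + \sum_(j < m) `|lc j|) *
  ((8 * K) ^ N * 2 ^ (m * (K + 2 * N + n)))%N%:R * n`!%:R ^+ m * `|a| ^+ N.
Proof.
move=> K0 alphaK a1 km.
set L := `|l0| + _; set F := _ * 'X^k.
have L0 : 0 <= L by rewrite addr_ge0// sumr_ge0.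
pose B : rat := (2 ^ N)%N%:R ^+ m * (2 ^ (K + N + n) * n`!)%N%:R ^+ m.
have FB i : (i <= N)%N -> `|F.[- i%:R]| <= B.
  move=> iN; rewrite hornerM normrM mulrC ler_pM//; last exact: normr_node_poly.
  rewrite hornerXn normrX normrN normr_nat.
  apply: (@le_trans _ _ ((2 ^ N)%N%:R ^+ k)).
    rewrite lerXn2r ?nnegrE// ler_nat.
    by rewrite (leq_trans iN)// ltnW// ltn_expl.
  by rewrite ler_weXn2l// ler1n expn_gt0.
have B0 : 0 <= B by rewrite mulr_ge0// exprn_ge0.
have a0 : 0 <= `|a| by [].
have term (l : nat) : (l <= N)%N ->
  `|newton_coef l F * a ^+ (N - l) * (l0 + \sum_(j < m) lc j * phi_psum (alpha j) a l)|
  <= L * (4 * K)%N%:R ^+ N * B * `|a| ^+ N.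
  move=> lN.
  have qB : `|newton_coef l F| <= 2 ^+ l * B / l`!%:R.
    by apply: normr_newton_coef => i il; apply: FB; exact: leq_trans lN.
  (* The factor l + 1 instead of l keeps T >= 1 at l = 0, so that T also absorbs the constant term
     l0. *)
  pose T : rat := l.+1%:R * (K%:R ^+ l * l`!%:R * `|a| ^+ l).
  have K1 : 1 <= K%:R ^+ l :> rat by rewrite exprn_ege1// ler1n.
  have al1 : 1 <= `|a| ^+ l by rewrite exprn_ege1.
  have f1 : 1 <= l`!%:R :> rat by rewrite ler1n fact_gt0.
  have KT : 1 <= K%:R ^+ l * l`!%:R * `|a| ^+ l by rewrite !mulr_ege1.
  have T1 : 1 <= T by rewrite mulr_ege1// ler1n.
  have ST : `|l0 + \sum_(j < m) lc j * phi_psum (alpha j) a l| <= L * T.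
    apply: le_trans (ler_normD _ _) _; rewrite mulrDl lerD ?ler_peMr//.
    apply: le_trans (ler_norm_sum _ _ _) _; rewrite mulr_suml ler_sum// => j _.
    rewrite normrM ler_wpM2l//; apply: le_trans (normr_phi_psum _ K0 (alphaK j) a1) _.
    by rewrite ler_wpM2r ?ler_nat// (le_trans ler01).
  move: (newton_coef l F) qB => q qB; rewrite !normrM normrX.
  apply: le_trans (ler_pM _ _ (ler_pM _ _ qB (lexx _)) ST) _ => //.
  have lf0 : l`!%:R != 0 :> rat by rewrite pnatr_eq0 -lt0n fact_gt0.
  (* The factorial growth of the partial sums cancels against the [l!] in the denominator of the
     Newton coefficient; only exponential factors remain besides B. *)
  have -> : 2 ^+ l * B / l`!%:R * `|a| ^+ (N - l) * (L * T) =
     L * (2 ^+ l * l.+1%:R * K%:R ^+ l) * B * (`|a| ^+ (N - l) * `|a| ^+ l).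
    by rewrite /T; field.
  rewrite -exprD subnK//; apply: ler_wpM2r; first exact: exprn_ge0.
  apply: ler_wpM2r => //; apply: ler_wpM2l => //.
  apply: (@le_trans _ _ ((4 * K)%N%:R ^+ l)); last first.
    by rewrite ler_weXn2l// ler1n muln_gt0.
  rewrite natrM exprMn ler_wpM2r ?exprn_ge0// (natrM _ 2 2) exprMn ler_wpM2l ?exprn_ge0//.
  by rewrite -natrX ler_nat ltn_expl.
apply: le_trans (ler_norm_sum _ _ _) _.
apply: (@le_trans _ _ (\sum_(l < N.+1) (L * (4 * K)%N%:R ^+ N * B * `|a| ^+ N))).
  by apply: ler_sum => l _; apply: term; rewrite -ltnS.
rewrite sumr_const card_ord -[leLHS]mulr_natl !mulrA ler_wpM2r ?exprn_ge0//.
rewrite -!mulrA mulrCA ler_wpM2l//.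
apply: (@le_trans _ _ (2 ^+ N * ((4 * K)%N%:R ^+ N * B))).
  rewrite ler_wpM2r ?mulr_ge0 ?exprn_ge0// -natrX ler_nat; exact: ltn_expl.
rewrite /B -!natrX -!natrM ler_nat.
rewrite !expnMn -!expnM (_ : 8 = 2 * 4)%N// expnMn.
rewrite (_ : m * (K + 2 * N + n) = N * m + (K + N + n) * m)%N; last by lia.
by rewrite expnD !mulnA.
Qed.

(** * p-adic size *)

Lemma padic_abs_nat_eq (p : prime_nat) (n : nat) : (0 < n)%N ->
  padic_abs p n%:R = (val p)%:R ^- logn (val p) n.
Proof.
move=> n0; have -> : n%:R = n%:Z%:~R / 1%:~R :> rat by rewrite divr1.
rewrite padic_absE//; last by rewrite -lt0n.
by rewrite logn1 expr0 div1r.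
Qed.

Lemma padic_abs_nat_le1 (p : prime_nat) (n : nat) : padic_abs p n%:R <= 1.
Proof.
case: n => [|n]; first by rewrite padic_abs0.
rewrite padic_abs_nat_eq// invf_le1 ?exprn_gt0 ?ltr0n ?prime_gt0 ?(valP p)//.
by rewrite exprn_ege1// ler1n prime_gt0 ?(valP p).
Qed.

Lemma padic_abs_int_le1 (p : prime_nat) (z : int) : padic_abs p z%:~R <= 1.
Proof.
case: z => n; first exact: padic_abs_nat_le1.
by rewrite NegzE mulrNz padic_absN; exact: padic_abs_nat_le1.
Qed.

Lemma padic_absX (p : prime_nat) (x : rat) n :
  padic_abs p (x ^+ n) = padic_abs p x ^+ n.
Proof.
by elim: n => [|n IH]; rewrite ?expr0 ?padic_abs1// !exprS padic_absM IH.
Qed.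

Lemma padic_abs_prod (p : prime_nat) I (r : seq I) (P : pred I) (F : I -> rat) :
  padic_abs p (\prod_(i <- r | P i) F i) = \prod_(i <- r | P i) padic_abs p (F i).
Proof. by apply: big_morph; [exact: padic_absM|exact: padic_abs1]. Qed.

Lemma padic_abs_sum_le (p : prime_nat) I (r : seq I) (P : pred I) (F : I -> rat) B :
  0 <= B -> (forall i, P i -> padic_abs p (F i) <= B) ->
  padic_abs p (\sum_(i <- r | P i) F i) <= B.
Proof.
move=> B0 FB; apply: (big_ind (fun x => padic_abs p x <= B)) => //.
by move=> x y xB yB; rewrite (le_trans (padic_absD _ _ _))// ge_max xB yB.
Qed.

Lemma padic_norm_sum_le (p : prime_nat) I (r : seq I) (P : pred I)
    (F : I -> padic p) B :
  0 <= B -> (forall i, P i -> padic_norm (F i) <= B) ->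
  padic_norm (\sum_(i <- r | P i) F i) <= B.
Proof.
move=> B0 FB; apply: (big_ind (fun x => padic_norm x <= B)) => //.
  by rewrite padic_norm0.
by move=> x y xB yB; rewrite (le_trans (padic_normD _ _))// ge_max xB yB.
Qed.

Lemma padic_abs_dvdn (p : prime_nat) d n : (d %| n)%N ->
  padic_abs p n%:R <= padic_abs p d%:R.
Proof.
move=> /dvdnP[k ->]; rewrite natrM padic_absM.
by rewrite ler_piMl ?padic_abs_ge0 ?padic_abs_nat_le1.
Qed.

Lemma padic_abs_nat_unit (p : prime_nat) (s : nat) : ~~ (val p %| s)%N ->
  padic_abs p s%:R = 1.
Proof.
move=> ps; rewrite padic_abs_nat_eq; last by case: s ps; rewrite ?dvdn0.
by rewrite lognE (negbTE ps) !andbF expr0 invr1.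
Qed.

Lemma padic_abs_le1_of_int_scale (p : prime_nat) (s : nat) (x : rat) :
  ~~ (val p %| s)%N -> s%:R * x \is a Num.int -> padic_abs p x <= 1.
Proof.
move=> /padic_abs_nat_unit ps /intrP[z zE].
have <- : padic_abs p (s%:R * x) = padic_abs p x by rewrite padic_absM ps mul1r.
by rewrite zE padic_abs_int_le1.
Qed.

Lemma padic_abs_le1_denq (p : prime_nat) (x : rat) : padic_abs p x <= 1 ->
  ~~ (val p %| `|denq x|)%N.
Proof.
move=> x1; apply/negP => pd.
have p1 : (val p == 1)%N = false by rewrite gtn_eqF ?prime_gt1 ?(valP p).
have [x0|x0] := eqVneq x 0; first by move: pd; rewrite x0 dvdn1 p1.
have := x1; rewrite /padic_abs (negbTE x0).
rewrite ler_pdivrMr ?exprn_gt0 ?ltr0n ?prime_gt0 ?(valP p)//.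
rewrite mul1r ler_eXn2l ?ltr1n ?prime_gt1 ?(valP p)// => dn.
have : (0 < logn (val p) `|numq x|)%N.
  by apply: leq_trans dn; rewrite logn_gt0 mem_primes (valP p) absz_gt0 denq_neq0 pd.
rewrite logn_gt0 mem_primes => /and3P[_ _ pn].
have := coprime_num_den x; rewrite /coprime => /eqP g1.
have : (val p %| gcdn `|numq x| `|denq x|)%N by rewrite dvdn_gcd pn pd.
by rewrite g1 dvdn1 p1.
Qed.

(** Natural numbers are dense in the p-integral rationals: invert the denominator modulo p^k by a
    Bezout relation. *)
Lemma padic_abs_approx_nat (p : prime_nat) (x : rat) (k : nat) :
  padic_abs p x <= 1 ->
  exists y : nat, padic_abs p (x - y%:R) <= (val p)%:R ^- k.
Proof.
move=> x1; have pd := padic_abs_le1_denq x1.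
pose P := (val p ^ k)%N.
have P0 : (0 < P)%N by rewrite expn_gt0 prime_gt0 ?(valP p).
have absP : padic_abs p P%:R = (val p)%:R ^- k.
  by rewrite padic_abs_nat_eq// pfactorK ?(valP p).
have cop : coprimez (denq x) P.
  by rewrite coprimezE coprime_sym coprimeXl// prime_coprime ?(valP p).
have [[u v] /= uv] := coprimezP _ _ cop.
pose y' := numq x * u.
have d1 : padic_abs p (denq x)%:~R = 1.
  by rewrite -absz_denq; exact: padic_abs_nat_unit.
have xy' : padic_abs p (x - y'%:~R) <= (val p)%:R ^- k.
  have -> : x - y'%:~R = (numq x)%:~R * v%:~R * P%:R / (denq x)%:~R.
    have d0 : (denq x)%:~R != 0 :> rat by rewrite intr_eq0 denq_neq0.
    rewrite -{1}[x]divq_num_den /y'.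
    have uvr : u%:~R * (denq x)%:~R + v%:~R * P%:R = 1 :> rat.
      by rewrite -[P%:R]/(P%:Z%:~R) -!intrM -intrD uv.
    apply: (mulIf d0); rewrite mulfVK// mulrBl mulfVK// intrM.
    have vP : v%:~R * P%:R = 1 - u%:~R * (denq x)%:~R :> rat.
      by apply/eqP; rewrite eq_sym subr_eq addrC uvr.
    by rewrite -[RHS]mulrA vP; ring.
  rewrite !padic_absM padic_absV d1 invr1 mulr1 absP ler_piMl ?invr_ge0 ?exprn_ge0//.
  by rewrite mulr_ile1 ?padic_abs_ge0 ?padic_abs_int_le1.
(* Reduction modulo p^k makes the approximation nonnegative without losing precision. *)
exists `|(y' %% P)%Z|%N.
have yE : (`|(y' %% P)%Z|%N%:R : rat) = y'%:~R - (y' %/ P)%Z%:~R * P%:R.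
  rewrite -[LHS]/((`|(y' %% P)%Z|%N)%:Z%:~R) gez0_abs ?modz_ge0 -?lt0n//.
  have -> : y'%:~R = (y' %/ P)%Z%:~R * P%:R + (y' %% P)%Z%:~R :> rat.
    by rewrite -[P%:R]/(P%:Z%:~R) -intrM -intrD -divz_eq.
  by rewrite addrC addKr.
rewrite yE opprB addrA addrAC addrC.
rewrite (le_trans (padic_absD _ _ _))// ge_max xy' andbT -absP padic_absM.
by rewrite ler_piMl ?padic_abs_ge0 ?padic_abs_int_le1.
Qed.

(** Exchange the factors one at a time; all of them are p-integral. *)
Lemma padic_abs_pochhammer_sub (p : prime_nat) (x y : rat) n :
  padic_abs p x <= 1 -> padic_abs p y <= 1 ->
  padic_abs p (pochhammer x n - pochhammer y n) <= padic_abs p (x - y).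
Proof.
move=> x1 y1; elim: n => [|n IH].
  by rewrite !pochhammer0 subrr padic_abs0 padic_abs_ge0.
have n1 z : padic_abs p z <= 1 -> padic_abs p (z + n%:R) <= 1.
  by move=> z1; rewrite (le_trans (padic_absD _ _ _))// ge_max z1 padic_abs_nat_le1.
have -> : pochhammer x n.+1 - pochhammer y n.+1 =
    (pochhammer x n - pochhammer y n) * (x + n%:R) + pochhammer y n * (x - y).
  by rewrite !pochhammerSr; ring.
rewrite (le_trans (padic_absD _ _ _))// !padic_absM ge_max; apply/andP; split.
  by rewrite -[leRHS]mulr1 ler_pM ?padic_abs_ge0// n1.
rewrite ler_piMl ?padic_abs_ge0// padic_abs_prod.
apply: prodr_ile1 => i _; rewrite padic_abs_ge0 (le_trans (padic_absD _ _ _))//.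
by rewrite ge_max y1 padic_abs_nat_le1.
Qed.

(** For a natural number y, n! divides (y)_n by integrality of binomial coefficients. Approximating
    x by such a y to precision |n!|_p transfers the bound to x. *)
Lemma padic_abs_pochhammer (p : prime_nat) (x : rat) n : padic_abs p x <= 1 ->
  padic_abs p (pochhammer x n) <= padic_abs p n`!%:R.
Proof.
move=> x1; have [y xy] := padic_abs_approx_nat (logn (val p) n`!) x1.
rewrite -padic_abs_nat_eq ?fact_gt0// in xy.
rewrite -[pochhammer x n](subrK (pochhammer y%:R n)).
rewrite (le_trans (padic_absD _ _ _))// ge_max; apply/andP; split.
  by apply: le_trans xy; apply: padic_abs_pochhammer_sub => //; exact: padic_abs_nat_le1.
have -> : pochhammer y%:R n = (\prod_(i < n) (y + i))%N%:R :> rat.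
  by rewrite natr_prod; apply: eq_bigr => i _; rewrite natrD.
apply: padic_abs_dvdn; case: y xy => [|y] _.
  by case: n => [|n]; rewrite ?big_ord0// big_ord_recl mul0n dvdn0.
by rewrite prod_addS_fact dvdn_mull.
Qed.

Lemma padic_norm_of_rat (p : prime_nat) (r : rat) :
  padic_norm (padic_of_rat p r) = padic_abs p r.
Proof. by rewrite -ratr_padicE padic_norm_ratr. Qed.

Lemma exists_padic_expn_lt (p : prime_nat) (e : rat) : 0 < e ->
  exists k, (val p)%:R ^- k < e.
Proof.
move=> e0; have [N _ /(_ N (leqnn _)) Ne] := near_infty_natSinv_lt (PosNum e0).
exists N; apply: le_lt_trans Ne.
rewrite lef_pV2; first by rewrite -natrX ler_nat ltn_expl// prime_gt1 ?(valP p).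
  by rewrite posrE exprn_gt0// ltr0n prime_gt0 ?(valP p).
by rewrite posrE ltr0n.
Qed.

Lemma padic_abs_fact_small (p : prime_nat) (e : rat) : 0 < e ->
  exists M, forall n, (M <= n)%N -> padic_abs p n`!%:R < e.
Proof.
move=> /(exists_padic_expn_lt p)[k ke]; exists (val p ^ k)%N => n pn.
apply: le_lt_trans ke.
have P0 : (0 < val p ^ k)%N by rewrite expn_gt0 prime_gt0 ?(valP p).
rewrite -[k in leRHS](pfactorK k (valP p)) -padic_abs_nat_eq//.
by apply: padic_abs_dvdn; rewrite dvdn_fact ?P0.
Qed.

(** * Convergence of the p-adic series and the remainder *)

Lemma padic_of_rat_phi_psum (p : prime_nat) (x : rat) (a : int) n :
  series (fun n => ratr (pochhammer x n) * (a%:~R : padic p) ^+ n) n =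
  padic_of_rat p (phi_psum x a%:~R n).
Proof.
rewrite /series/= /phi_psum big_mkord rmorph_sum/=; apply: eq_bigr => i _.
by rewrite rmorphM rmorphXn/= ratr_padicE rmorph_int.
Qed.

Lemma padic_phi_cvg (p : prime_nat) (x : rat) (a : int) (e : rat) :
  padic_abs p x <= 1 -> 0 < e ->
  exists M, forall n, (M <= n)%N ->
    padic_norm (padic_of_rat p (phi_psum x a%:~R n) - padic_phi x (a%:~R : padic p))
    < e.
Proof.
move=> x1; move: e.
pose u : nat -> padic p := series (fun n => ratr (pochhammer x n) * a%:~R ^+ n).
have [l ul] : exists l : padic p, u @ \oo --> l.
  apply: (@padic_complete p u) => e e0.
  have e20 : 0 < e / 2 by rewrite divr_gt0.
  have [M MP] := padic_abs_fact_small p e20.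
  exists M.
  have uM m n : (M <= m)%N -> (m <= n)%N -> padic_norm (u n - u m) < e.
    move=> Mm mn; rewrite /u !padic_of_rat_phi_psum -rmorphB/= padic_norm_of_rat.
    apply: (@le_lt_trans _ _ (e / 2)); last by lra.
    rewrite /phi_psum -!(big_mkord predT (fun i => pochhammer x i * a%:~R ^+ i)).
    rewrite (big_cat_nat (leq0n m) mn)/= addrAC subrr add0r big_nat_cond.
    apply: padic_abs_sum_le => [|i /andP[/andP[mi _] _]]; first exact: ltW.
    rewrite padic_absM padic_absX -[leRHS]mulr1.
    apply: ler_pM; rewrite ?padic_abs_ge0 ?exprn_ge0 ?padic_abs_ge0//.
      apply: le_trans (padic_abs_pochhammer _ x1) _.
      by apply/ltW/MP; exact: leq_trans mi.
    by rewrite exprn_ile1 ?padic_abs_ge0 ?padic_abs_int_le1.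
  move=> m n Mm Mn; have [mn|nm] := leqP m n; last exact: uM (ltnW nm).
  by rewrite -padic_normN opprB; exact: uM.
(* Existence of some limit is enough: [padic_phi] is [limn] of this very sequence. *)
have : u @ \oo --> padic_phi x (a%:~R : padic p) by exact: (cvgP l ul).
move=> /padic_cvgP uphi e /uphi[M MP]; exists M => n /MP.
by rewrite /u padic_of_rat_phi_psum.
Qed.

(** The remainder identity, truncated to M terms. For fixed h, (x)_(h+l) = (x)_h (x+h)_l and a^(N-l)
    a^(l+h) = a^(N+h), so the sum over l reassembles the Newton expansion of F at x + h. *)
Lemma sum_newton_coef_psum (x a : rat) N (F : {poly rat}) M : (size F <= N.+1)%N ->
  \sum_(l < N.+1) newton_coef l F * a ^+ (N - l) *
    (phi_psum x a (l + M) - phi_psum x a l) =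
  \sum_(h < M) a ^+ (N + h) * pochhammer x h * F.[x + h%:R].
Proof.
move=> sF.
have psumB l : phi_psum x a (l + M) - phi_psum x a l =
    \sum_(h < M) pochhammer x (h + l) * a ^+ (l + h).
  rewrite /phi_psum big_split_ord/= addrAC subrr add0r.
  by apply: eq_bigr => h _; rewrite addnC.
under eq_bigr do rewrite psumB mulr_sumr.
rewrite exchange_big/=; apply: eq_bigr => h _.
rewrite [in RHS](newton_expansion sF) horner_sum mulr_sumr; apply: eq_bigr => l _.
have lN : (l <= N)%N by rewrite -ltnS.
have -> : (N + h = N - l + (l + h))%N by rewrite addnA subnK.
by rewrite hornerZ horner_rising pochhammerD !exprD; ring.
Qed.

(** For each j the n factors form, up to sign, the Pochhammer symbol (alpha_j - x)_n. *)
Lemma padic_abs_node_poly (p : prime_nat) m (alpha : 'I_m -> rat) (n : nat) (x : rat) :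
  (forall j, padic_abs p (alpha j) <= 1) -> padic_abs p x <= 1 ->
  padic_abs p (node_poly alpha n).[x] <= padic_abs p (n`!%:R ^+ m).
Proof.
move=> alpha1 x1; rewrite horner_node_poly padic_abs_prod padic_absX.
have -> : forall y : rat, y ^+ m = \prod_(j < m) y.
  by move=> y; rewrite prodr_const card_ord.
apply: ler_prod => j _; rewrite padic_abs_ge0/=.
apply: (@le_trans _ _ (padic_abs p (pochhammer (alpha j - x) n))).
  rewrite !padic_abs_prod ler_prod// => i _; rewrite padic_abs_ge0/=.
  by rewrite -padic_absN opprB addrAC.
apply: padic_abs_pochhammer.
by rewrite (le_trans (padic_absD _ _ _))// padic_absN ge_max alpha1 x1.
Qed.

Lemma padic_abs_newton_coef_node (p : prime_nat) m (alpha : 'I_m -> rat) (s n k l : nat) :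
  (forall j, s%:R * alpha j \is a Num.int) -> ~~ (val p %| s)%N ->
  padic_abs p (newton_coef l (node_poly alpha n * 'X^k)) <= 1.
Proof.
move=> salpha ps; set q := newton_coef _ _.
have -> : padic_abs p q = padic_abs p (s%:R ^+ (m * n) * q).
  by rewrite padic_absM padic_absX padic_abs_nat_unit// expr1n mul1r.
rewrite /q -newton_coefZ; have [G ->] := node_poly_int_scale n k salpha.
by have [z ->] := newton_coef_int G l; exact: padic_abs_int_le1.
Qed.

Lemma padic_abs_approximant (p : prime_nat) m (alpha : 'I_m -> rat) (s n k : nat)
    (a l0 : int) (lc : 'I_m -> int) :
  (forall j, s%:R * alpha j \is a Num.int) -> ~~ (val p %| s)%N -> (k <= m)%N ->
  a != 0 ->
  l0%:~R + \sum_(j < m) (lc j)%:~R * padic_phi (alpha j) (a%:~R : padic p) = 0 ->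
  padic_abs p (approximant alpha a%:~R l0%:~R (fun j => (lc j)%:~R) (m * n + m)
    (node_poly alpha n * 'X^k)) <=
  padic_abs p (a%:~R ^+ (m * n + n) * n`!%:R ^+ m.+1).
Proof.
move=> salpha ps km a0 rel; set N := (m * n + m)%N; set F := _ * 'X^k.
set Y := a%:~R ^+ _ * _; set ar : rat := a%:~R.
have sF : (size F <= N.+1)%N by exact: size_node_polyXn.
have alpha1 j := padic_abs_le1_of_int_scale ps (salpha j).
have Y0 : 0 < padic_abs p Y.
  have f0 : n`!%:R != 0 :> rat by rewrite pnatr_eq0 -lt0n fact_gt0.
  by rewrite padic_abs_gt0 mulf_neq0// expf_neq0// intr_eq0.
have /choice[M0 M0P] : forall j : 'I_m, exists M, forall i, (M <= i)%N ->
    padic_norm (padic_of_rat p (phi_psum (alpha j) ar i)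
                - padic_phi (alpha j) (a%:~R : padic p)) < padic_abs p Y.
  by move=> j; exact: padic_phi_cvg.
(* One truncation for all j, at which every partial sum is within |Y|_p of its limit; |Y|_p > 0
   because a is nonzero. *)
pose M := (\max_(j < m) M0 j)%N.
pose T j := \sum_(h < M) ar ^+ (N + h) * pochhammer (alpha j) h * F.[alpha j + h%:R].
(* Terms with h < n vanish at the nodes. For h >= n, the power of a gives |a|^(mn+n), (alpha_j)_h
   gives one |n!|, and the node polynomial gives the other m. *)
have TY j : padic_abs p (T j) <= padic_abs p Y.
  apply: padic_abs_sum_le => [|h _]; first exact: ltW.
  have [hn|nh] := ltnP h n.
    by rewrite hornerM node_poly_root// mul0r mulr0 padic_abs0 ltW.
  have ah1 : padic_abs p (alpha j + h%:R) <= 1.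
    by rewrite (le_trans (padic_absD _ _ _))// ge_max alpha1 padic_abs_nat_le1.
  rewrite /Y exprS mulrA !padic_absM.
  apply: ler_pM; rewrite ?mulr_ge0 ?padic_abs_ge0//.
    apply: ler_pM; rewrite ?padic_abs_ge0//.
      rewrite !padic_absX ler_wiXn2l ?padic_abs_ge0 ?padic_abs_int_le1//.
      by rewrite /N -addnA leq_add2l (leq_trans nh) ?leq_addl.
    apply: le_trans (padic_abs_pochhammer _ (alpha1 j)) _.
    by apply: padic_abs_dvdn; exact: dvdn_fact_fact.
  rewrite hornerM padic_absM hornerXn padic_absX -[leRHS]mulr1.
  apply: ler_pM; rewrite ?exprn_ge0 ?padic_abs_ge0//.
    exact: padic_abs_node_poly.
  by rewrite exprn_ile1 ?padic_abs_ge0.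
set A := approximant _ _ _ _ _ _.
(* Adding the [T j] extends each partial sum of length l to length l + M. *)
have -> : A = (A + \sum_(j < m) (lc j)%:~R * T j) - \sum_(j < m) (lc j)%:~R * T j.
  by rewrite addrK.
rewrite (le_trans (padic_absD _ _ _))// padic_absN ge_max; apply/andP; split; last first.
  apply: padic_abs_sum_le => [|j _]; first exact: ltW.
  rewrite padic_absM; apply: le_trans (TY j).
  by rewrite ler_piMl ?padic_abs_ge0 ?padic_abs_int_le1.
rewrite -padic_norm_of_rat.
have -> : A + \sum_(j < m) (lc j)%:~R * T j =
   \sum_(l < N.+1) newton_coef l F * ar ^+ (N - l) *
     (l0%:~R + \sum_(j < m) (lc j)%:~R * phi_psum (alpha j) ar (l + M)).
  rewrite /A /approximant.
  under [X in _ + X]eq_bigr do rewrite /T -sum_newton_coef_psum// mulr_sumr.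
  rewrite exchange_big/= -big_split/=; apply: eq_bigr => l _.
  under [X in _ + X]eq_bigr do rewrite mulrCA.
  rewrite -mulr_sumr -mulrDr -addrA -big_split/=; congr (_ * (_ + _)).
  by apply: eq_bigr => j _; ring.
rewrite rmorph_sum/=; apply: padic_norm_sum_le => [|l _]; first exact: ltW.
rewrite rmorphM/= padic_normM padic_norm_of_rat -[leRHS]mul1r.
apply: ler_pM; rewrite ?padic_abs_ge0 ?padic_norm_ge0//.
  rewrite padic_absM padic_absX mulr_ile1 ?exprn_ge0 ?padic_abs_ge0//.
    exact: padic_abs_newton_coef_node ps.
  by rewrite exprn_ile1 ?padic_abs_ge0 ?padic_abs_int_le1.
(* Subtracting the vanishing p-adic relation leaves only the errors of the partial sums. *)
rewrite -[padic_of_rat _ _]subr0 -rel rmorphD rmorph_sum/= rmorph_int.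
rewrite opprD addrACA subrr add0r -sumrB.
apply: padic_norm_sum_le => [|j _]; first exact: ltW.
rewrite rmorphM/= rmorph_int -mulrBr padic_normM -[leRHS]mul1r.
apply: ler_pM; rewrite ?padic_norm_ge0//.
  by rewrite -(rmorph_int (padic_of_rat p)) padic_norm_of_rat padic_abs_int_le1.
apply/ltW/M0P; apply: leq_trans (leq_addl _ _).
exact: leq_bigmax.
Qed.

(** * Product over primes *)

Lemma padic_abs_absz (p : prime_nat) (z : int) :
  padic_abs p `|z|%N%:R = padic_abs p z%:~R.
Proof. by case: z => // n; rewrite NegzE mulrNz padic_absN abszN. Qed.

Lemma partn_primes (pi : nat_pred) n : (0 < n)%N ->
  (n`_pi = \prod_(q <- primes n | q \in pi) q ^ logn q n)%N.
Proof.
move=> n0; rewrite /partn.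
rewrite (bigID (fun q => q \in primes n))/= [X in (_ * X)%N]big1 ?muln1; last first.
  by move=> q /andP[_]; rewrite -logn_gt0 lt0n negbK => /eqP ->.
under eq_bigl do rewrite andbC.
rewrite -big_filter_cond; apply: perm_big.
apply: uniq_perm; rewrite ?filter_uniq ?iota_uniq ?primes_uniq// => q.
rewrite mem_filter mem_index_iota; case: (boolP (q \in primes n)) => //=.
by rewrite mem_primes ltnS => /and3P[_ _ /dvdn_leq ->].
Qed.

(** Recasts the set as a [nat_pred], so that [partn] gives the P-part of an integer. *)
Definition primes_of (P : set prime_nat) : nat_pred :=
  [pred q : nat | `[< exists2 p : prime_nat, P p & val p = q >]].

(** P may be infinite, but only the prime divisors of n contribute a factor different from 1, so the
    product has finite support. *)
Lemma fsprod_padic_abs (R : realType) (P : set prime_nat) (n : nat) : (0 < n)%N ->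
  \big[*%R/1]_(p \in P) (ratr (padic_abs p n%:R) : R) =
  (n`_(primes_of P))%N%:R^-1.
Proof.
move=> n0.
have absE (p : prime_nat) : ratr (padic_abs p n%:R) = (val p)%:R ^- logn (val p) n :> R.
  by rewrite padic_abs_nat_eq// fmorphV rmorphXn/= ratr_nat.
pose r : seq prime_nat := pmap insub (primes n).
have rE (p : prime_nat) : (p \in r) = (val p \in primes n) by rewrite mem_pmap_sub.
have ur : uniq r by rewrite pmap_sub_uniq// primes_uniq.
rewrite (fsbigE [seq p <- r | p \in P]) ?filter_uniq//; last 2 first.
- by move=> p /=; rewrite mem_filter => /andP[/set_mem].
- move=> p Pp; rewrite mem_filter mem_set//= rE absE.
  by rewrite -logn_gt0 lt0n negbK => /eqP ->; rewrite expr0 invr1.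
rewrite big_filter_cond/= partn_primes// natr_prod -prodfV.
have vr : map val r = primes n.
  rewrite pmap_filter; last exact: insubK.
  apply/all_filterP/allP => q; rewrite mem_primes => /andP[pq _].
  by rewrite isSome_insub.
rewrite -[in RHS]vr big_map; apply: eq_big => [p|p _].
  rewrite andbb; apply/idP/idP => [/set_mem Pp|/asboolP[q Pq /val_inj <-]].
    by apply/asboolP; exists p.
  exact: mem_set.
by rewrite absE natrX.
Qed.

(** M is the multinomial coefficient (mn)! / n!^m, a product of binomials each at most 2^(mn). It
    lets (mn)! replace n!^m at exponential cost. *)
Lemma fact_exp_dvdn m n :
  exists2 M, ((m * n)`! = M * n`! ^ m)%N & (M <= 2 ^ (m * m * n))%N.
Proof.
elim: m => [|m [M ME MB]]; first by exists 1%N.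
exists ('C(m.+1 * n, n) * M)%N.
  have := @bin_fact (m.+1 * n) n; rewrite {2}mulSn leq_addr => /(_ isT) <-.
  by rewrite mulSn addKn ME expnS; nia.
apply: (@leq_trans (2 ^ (m.+1 * n) * 2 ^ (m * m * n))).
  by rewrite leq_mul// bin_leq_2exp.
by rewrite -expnD leq_exp2l//; nia.
Qed.

(** The product formula as divisibility: the approximant times a power of s is a nonzero integer z
    divisible by the P-part of Y, so that part is at most |z|. The bound separates a factor
    independent of n from one independent of the relation. *)
Lemma partn_bound m (alpha : 'I_m -> rat) (s K : nat) (P : set prime_nat)
    (n k : nat) (a l0 : int) (lc : 'I_m -> int) :
  (forall j, s%:R * alpha j \is a Num.int) -> (0 < s)%N ->
  (0 < K)%N -> (forall j, `|alpha j| <= K%:R) ->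
  (forall p, P p -> ~~ (val p %| s)%N) -> a != 0 -> (k <= m)%N ->
  (forall p : prime_nat, P p ->
    l0%:~R + \sum_(j < m) (lc j)%:~R * padic_phi (alpha j) (a%:~R : padic p) = 0) ->
  approximant alpha a%:~R l0%:~R (fun j => (lc j)%:~R) (m * n + m)
    (node_poly alpha n * 'X^k) != 0 ->
  (((`|a|%N ^ (m * n + n + 1) * (m * n)`! * (n + 1)`!)`_(primes_of P))%N <=
   (s ^ m * (`|l0| + \sum_(j < m) `|lc j|) * (8 * K) ^ m
      * 2 ^ (m * (K + 2 * m)) * `|a| ^ m)
   * ((s ^ (2 * m) * (8 * K) ^ m * 2 ^ (3 * m * m + m + 1)) ^ n
      * `|a| ^ (m * n + 1) * (m * n)`!))%N.
Proof.
move=> salpha s0 K0 alphaK Ps a0 km rel; set A := approximant _ _ _ _ _ _ => A0.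
pose N := (m * n + m)%N.
have aa0 : (0 < `|a|)%N by rewrite absz_gt0.
have /intrP[z zE] : s%:R ^+ (m * n + N) * A \is a Num.int by exact: approximant_int.
have z0 : (0 < `|z|)%N.
  rewrite absz_gt0 -(intr_eq0 rat) -zE mulf_neq0// expf_neq0//.
  by rewrite pnatr_eq0 -lt0n.
set L := (`|l0| + _)%N.
have zB : (`|z| <= s ^ (m * n + N) * (L * ((8 * K) ^ N * 2 ^ (m * (K + 2 * N + n)))
    * n`! ^ m * `|a| ^ N))%N.
  rewrite -(ler_nat rat) natr_absz intr_norm -zE normrM normrX normr_nat.
  rewrite natrM natrX ler_wpM2l ?exprn_ge0//.
  have a1 : 1 <= `|a%:~R : rat| by rewrite -intr_norm -natr_absz ler1n.
  apply: le_trans (normr_approximant N n l0%:~R (fun j => (lc j)%:~R) K0 alphaK a1 km) _.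
  have -> : `|l0%:~R| + \sum_(j < m) `|(lc j)%:~R| = L%:R :> rat.
    rewrite natrD natr_sum natr_absz intr_norm; congr (_ + _).
    by apply: eq_bigr => j _; rewrite natr_absz intr_norm.
  by rewrite -intr_norm -natr_absz -!natrX -!natrM ler_nat.
pose Y := (`|a| ^ (m * n + n) * n`! ^ m.+1)%N.
have Y0 : (0 < Y)%N by rewrite muln_gt0 !expn_gt0 aa0 fact_gt0.
(* Checked one prime of P at a time, by comparing p-adic valuations. *)
have Yz : (Y`_(primes_of P) %| `|z|)%N.
  apply/dvdn_partP => [|q]; first exact: part_gt0.
  rewrite pi_of_part// inE/= => /andP[qY /asboolP[p Pp pq]].
  rewrite partn_part; last first.
    by move=> q' ; rewrite inE => /eqP ->; apply/asboolP; exists p.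
  rewrite p_part pfactor_dvdn//; last by rewrite -pq (valP p).
  have absz : padic_abs p `|z|%:R <= padic_abs p Y%:R.
    rewrite padic_abs_absz -zE padic_absM padic_absX padic_abs_nat_unit ?Ps//.
    rewrite expr1n mul1r.
    have -> : padic_abs p Y%:R = padic_abs p (a%:~R ^+ (m * n + n) * n`!%:R ^+ m.+1).
      rewrite natrM !natrX !padic_absM !padic_absX; congr (_ ^+ _ * _).
      exact: padic_abs_absz.
    exact: padic_abs_approximant salpha (Ps _ Pp) km a0 (rel _ Pp).
  move: absz; rewrite !padic_abs_nat_eq//.
  rewrite lef_pV2 ?posrE ?exprn_gt0 ?ltr0n ?prime_gt0 ?(valP p)//.
  by rewrite ler_eXn2l ?ltr1n ?prime_gt1 ?(valP p)// pq.
have [M ME MB] := fact_exp_dvdn m n.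
have M0 : (0 < M)%N by have := fact_gt0 (m * n); rewrite ME muln_gt0 => /andP[].
(* The surplus over Y is |a| M (n+1), whose P-part is bounded by the number itself, with n + 1 <=
   2^n. *)
have -> : (`|a|%N ^ (m * n + n + 1) * (m * n)`! * (n + 1)`! = Y * (`|a| * M * n.+1))%N.
  by rewrite /Y ME !addn1 factS !expnS; nia.
rewrite partnM// ?muln_gt0 ?aa0 ?M0//.
apply: leq_trans (leq_mul (dvdn_leq z0 Yz)
  (dvdn_leq _ (dvdn_part (primes_of P) (`|a| * M * n.+1)))) _.
  by rewrite !muln_gt0 aa0 M0.
apply: leq_trans (leq_mul zB (leq_mul (leq_mul (leqnn _) MB) (ltn_expl n (ltnSn 1)))) _.
have nm : (n`! ^ m <= (m * n)`!)%N by rewrite ME leq_pmull.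
have sE : (s ^ (m * n + N) = s ^ m * (s ^ (2 * m)) ^ n)%N.
  by rewrite -expnM -expnD /N; congr expn; lia.
have KE : ((8 * K) ^ N = (8 * K) ^ m * ((8 * K) ^ m) ^ n)%N.
  by rewrite -expnM -expnD /N; congr expn; lia.
have twoE : (2 ^ (m * (K + 2 * N + n)) * 2 ^ (m * m * n) * 2 ^ n =
    2 ^ (m * (K + 2 * m)) * (2 ^ (3 * m * m + m + 1)) ^ n)%N.
  by rewrite -expnM -!expnD /N; congr expn; lia.
have aE : (`|a| ^ N * `|a| = `|a| ^ m * `|a| ^ (m * n + 1))%N.
  by rewrite -expnSr -expnD /N; congr expn; lia.
have -> : (s ^ (m * n + N) *
    (L * ((8 * K) ^ N * 2 ^ (m * (K + 2 * N + n))) * n`! ^ m * `|a| ^ N) *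
    (`|a| * 2 ^ (m * m * n) * 2 ^ n) =
    s ^ (m * n + N) * L * (8 * K) ^ N *
    (2 ^ (m * (K + 2 * N + n)) * 2 ^ (m * m * n) * 2 ^ n) *
    (`|a| ^ N * `|a|) * n`! ^ m)%N by lia.
rewrite sE KE twoE aE [leqRHS]mulnA leq_mul//.
rewrite (expnMn (s ^ (2 * m) * _))%N (expnMn (s ^ (2 * m)))%N.
lia.
Qed.

(** * Contradiction with the limsup hypothesis *)

Theorem theorem1 (R : realType) (m : nat) (alpha : 'I_m -> rat)
    (m_gt0 : (0 < m)%N)
    (alpha_nonpos : forall (j : 'I_m) (k : nat), alpha j <> - k%:R)
    (alpha_diff : forall i j : 'I_m, i <> j -> alpha i - alpha j \isn't a Num.int) :
  let s := (\big[lcmn/1%N]_(j < m) `|denq (alpha j)|)%N in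
  exists2 c : R, 0 < c &
    forall (a : int) (P1 : set prime_nat),
      a <> 0 ->
      (forall p : prime_nat, P1 p -> ~~ (val p %| s)%N) ->
      limn_esup (fun n : nat =>
        (c ^+ n * `|a|%:~R ^+ (m * n + 1) * ((m * n)`!)%N%:R *
         \big[*%R/1]_(p \in P1)
            (ratr (padic_abs p
              (a%:~R ^+ (m * n + n + 1) * ((m * n)`!)%N%:R * ((n + 1)`!)%N%:R)) : R))%:E)
        = 0%E ->
      ~ exists l : 'rV[int]_m.+1, l <> 0 /\
          forall p : prime_nat, P1 p ->
            (l ord0 ord0)%:~R
              + \sum_(j < m) (l ord0 (lift ord0 j))%:~R
                             * padic_phi (alpha j) (a%:~R : padic p) = 0.
Proof.
move=> s.
have s_gt0 : (0 < s)%N.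
  rewrite /s; elim/big_ind: _ => // [x y x0 y0|j _]; first by rewrite lcmn_gt0 x0.
  by rewrite absz_gt0 denq_neq0.
have salpha j : s%:R * alpha j \is a Num.int.
  have : (`|denq (alpha j)| %| s)%N by exact: (biglcmn_sup j).
  move=> /dvdnP[k ->]; rewrite natrM -mulrA natr_absz gtr0_norm ?denq_gt0//.
  by rewrite [X in _ * X]mulrC -numqE rpredM ?natr_int ?intr_int.
pose K := (\sum_(j < m) Num.bound `|alpha j|).+1.
have alphaK j : `|alpha j| <= K%:R.
  apply: (le_trans (ltW (archi_boundP (normr_ge0 (alpha j))))).
  by rewrite ler_nat /K ltnW// ltnS (bigD1 j)//= leq_addr.
(* C involves only s, K and m, hence only the alpha_j; a enters [B] and [D], and the relation enters
   [D] alone. *)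
pose C := (s ^ (2 * m) * (8 * K) ^ m * 2 ^ (3 * m * m + m + 1))%N.
have C_gt0 : (0 < C)%N by rewrite !muln_gt0 !expn_gt0 s_gt0 muln_gt0.
exists C%:R; first by rewrite ltr0n.
move=> a P1 /eqP a0 Ps limsup0 [l [l0 rel]].
pose lc j := l ord0 (lift ord0 j).
pose D := (s ^ m * (`|l ord0 ord0| + \sum_(j < m) `|lc j|) * (8 * K) ^ m
  * 2 ^ (m * (K + 2 * m)) * `|a| ^ m)%N.
pose X n := (`|a| ^ (m * n + n + 1) * (m * n)`! * (n + 1)`!)%N.
pose B n := (C ^ n * `|a| ^ (m * n + 1) * (m * n)`!)%N.
have aa0 : (0 < `|a|)%N by rewrite absz_gt0.
have X_gt0 n : (0 < X n)%N by rewrite !muln_gt0 expn_gt0 aa0 !fact_gt0.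
have XB n : ((X n)`_(primes_of P1) <= D * B n)%N.
  (* The exponent k may vary with n; the resulting bound does not depend on it. *)
  have /existsNP[k /not_implyP[km A0]] : ~ forall k, (k <= m)%N ->
      newton_form (relation_coef alpha a%:~R (l ord0 ord0)%:~R (fun j => (lc j)%:~R))
        (node_poly alpha n * 'X^k) = 0.
    have aq0 : (a%:~R : rat) != 0 by rewrite intr_eq0.
    move=> /(newton_form_relation_eq0 aq0 alpha_nonpos alpha_diff)[/eqP l00 lc0].
    apply: l0; apply/rowP => i; rewrite mxE.
    case: (unliftP ord0 i) => [j|] ->; apply/eqP; last by rewrite -(intr_eq0 rat).
    by rewrite -(intr_eq0 rat); apply/eqP; exact: lc0.
  apply: (partn_bound salpha s_gt0 (ltn0Sn _) alphaK Ps a0 km rel).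
  rewrite approximantE ?intr_eq0 ?size_node_polyXn//.
  by rewrite mulf_neq0 ?expf_neq0 ?intr_eq0//; exact/eqP.
(* At n = 0 the positive P-part of [X 0] is at most [D * B 0], so D cannot be 0. *)
have D_gt0 : (0 < D)%N.
  have := leq_trans (part_gt0 (primes_of P1) (X 0)) (XB 0).
  by rewrite muln_gt0 => /andP[].
set u := (fun n : nat => _) in limsup0.
have uE n : u n = ((B n)%:R / ((X n)`_(primes_of P1))%N%:R)%:E.
  rewrite /u; congr EFin; congr (_ * _).
    by rewrite (natrM _ (C ^ n * _)) (natrM _ (C ^ n)) !natrX natr_absz.
  rewrite -(fsprod_padic_abs R P1 (X_gt0 n)).
  apply: eq_fsbigr => p _; congr ratr.
  by rewrite /X !natrM natrX !padic_absM !padic_absX padic_abs_absz.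
(* The terms in the limsup stay above the fixed positive number 1/D. *)
have u_ge n : ((D%:R^-1)%:E <= u n)%E.
  rewrite uE lee_fin ler_pdivlMr ?ltr0n ?part_gt0// mulrC ler_pdivrMr ?ltr0n//.
  by rewrite -natrM ler_nat mulnC XB.
(* For nonnegative terms, limsup 0 already means convergence to 0. *)
have : (u @ \oo --> 0%E).
  apply: limn_esup_le_cvg; first by rewrite limsup0.
  by move=> n; apply: le_trans (u_ge n); rewrite lee_fin invr_ge0.
move=> u0; have : ((D%:R^-1)%:E <= (0 : \bar R))%E.
  have -> : 0%E = limn u by apply/esym/cvg_lim.
  by apply: lime_ge; [exact: cvgP u0|exact: nearW].
by rewrite lee_fin leNgt invr_gt0 ltr0n D_gt0.
Qed.
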